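(* Let $n\ge 2$ be an integer, let $J \subset \mathbb{N}$ be an infinite set, and let $q\in\mathbb{N}_0$ be fixed. Then any closed subspace $X$ of $C(\mathbb{S}^{n-1})$ that contains $$\mathcal{H}_{J,q} := \overline{\operatorname{span}\big\{ \mathcal{H}_{p,q}(\mathbb{S}^{n-1}) : p \in J \big\}}$$ (closure in $C(\mathbb{S}^{n-1})$) is not compactly included in $L_1(\mathbb{S}^{n-1}, \sigma_n)$; that is, the inclusion map $X\hookrightarrow L_1(\mathbb{S}^{n-1},\sigma_n)$ is not a compact operator.
   Context: $\mathbb{S}^{n-1}=\{z\in\mathbb{C}^n:\|z\|_2=1\}$ is the complex Euclidean sphere, $\sigma_n$ its normalized rotation-invariant measure, and $C(\mathbb{S}^{n-1})$ the space of continuous complex-valued functions on it with the supremum norm. For integers $p,q\ge 0$, $\mathcal{H}_{p,q}(\mathbb{C}^n)$ is the space of functions $f(z)=\sum_{|\alpha|=p,|\beta|=q}c_{(\alpha,\beta)}z^\alpha\overline{z}^\beta$ on $\mathbb{C}^n$ ($\alpha,\beta\in\mathbb{N}_0^n$, $c_{(\alpha,\beta)}\in\mathbb{C}$) with $\Delta f=0$, where $\Delta=\sum_{j=1}^n\frac{\partial^2}{\partial z_j\partial\overline{z_j}}$. $\mathcal{H}_{p,q}(\mathbb{S}^{n-1})\subset C(\mathbb{S}^{n-1})$ is the space of restrictions of these functions to $\mathbb{S}^{n-1}$. *)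

(* Defs.v *)
From HB Require Import structures.
From mathcomp Require Import all_boot all_order all_algebra.
From mathcomp Require Import all_classical all_reals all_analysis.
From mathcomp Require Import measurable_realfun.
From mathcomp Require Import complex.

Set Implicit Arguments.
Unset Strict Implicit.
Unset Printing Implicit Defensive.

Import Order.TTheory GRing.Theory Num.Theory numFieldNormedType.Exports.
Export numFieldNormedType.Exports.

Local Open Scope classical_set_scope.
Local Open Scope ring_scope.
Local Open Scope complex_scope.

Local Notation Re := complex.Re.
Local Notation Im := complex.Im.
Notation normc := ComplexField.Normc.normc.

HB.instance Definition _ (R : realType) := NormedModule.copy R[i] R[i]^o.

Section complex_modulus.
Context {R : realType}.
Implicit Types z w : R[i].

Lemma normc_normr z : `|z| = (normc z)%:C.
Proof. by case: z. Qed.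

Lemma normc_ge0 z : 0 <= normc z.
Proof. by case: z => a b; exact: sqrtr_ge0. Qed.

Lemma normcB z w : normc (z - w) = normc (w - z).
Proof. by rewrite -(normcN (z - w)) opprB. Qed.

Lemma normc_sqrt z : normc z = Num.sqrt (Re z ^+ 2 + Im z ^+ 2).
Proof. by case: z. Qed.

Lemma normr_Re_le z : `|Re z| <= normc z.
Proof. by rewrite -lecR -normc_normr normc_ge_Re. Qed.

Lemma normr_Im_le z : `|Im z| <= normc z.
Proof.
rewrite normc_sqrt -[leLHS](sqrtr_sqr (Im z) : _) ler_wsqrtr//.
by rewrite lerDr sqr_ge0.
Qed.

Lemma normc_le_ReIm z : normc z <= `|Re z| + `|Im z|.
Proof.
rewrite normc_sqrt -(@ler_pXn2r _ 2)// ?nnegrE ?sqrtr_ge0 ?addr_ge0//.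
rewrite sqr_sqrtr ?addr_ge0 ?sqr_ge0// sqrrD !real_normK ?num_real//.
by rewrite addrAC lerDl mulrn_wge0// mulr_ge0.
Qed.

Lemma continuous_Re : continuous (@Re R : R[i] -> R).
Proof.
move=> z; apply/(@cvgrPdist_lt _ _ _ (nbhs z)) => e e0.
have eC : 0 < e%:C by rewrite ltcR.
near=> w.
have : `|z - w| < e%:C by near: w; exact: cvgr_dist_lt.
rewrite normc_normr ltcR; apply: le_lt_trans.
rewrite (_ : Re z - Re w = Re (z - w)) ?normr_Re_le//.
by case: (z) (w) => ? ? [].
Unshelve. all: by end_near. Qed.

Lemma continuous_Im : continuous (@Im R : R[i] -> R).
Proof.
move=> z; apply/(@cvgrPdist_lt _ _ _ (nbhs z)) => e e0.
have eC : 0 < e%:C by rewrite ltcR.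
near=> w.
have : `|z - w| < e%:C by near: w; exact: cvgr_dist_lt.
rewrite normc_normr ltcR; apply: le_lt_trans.
rewrite (_ : Im z - Im w = Im (z - w)) ?normr_Im_le//.
by case: (z) (w) => ? ? [].
Unshelve. all: by end_near. Qed.

End complex_modulus.

Section sphere.
Context (R : realType) (n : nat).

Definition norm2 (z : 'rV[R[i]]_n) : R :=
  Num.sqrt (\sum_(j < n) normc (z 0 j) ^+ 2).

Definition unit_sphere : set 'rV[R[i]]_n := [set z | norm2 z = 1].

Definition sphere : Type := set_type unit_sphere.
HB.instance Definition _ := Uniform.on sphere.

Definition sphere_val (z : sphere) : 'rV[R[i]]_n := \val z.

Lemma sphere_valP (z : sphere) : norm2 (sphere_val z) = 1.
Proof. exact: (set_mem (valP z)). Qed.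

Lemma sphere_val_inj : injective sphere_val.
Proof. exact: val_inj. Qed.

Definition to_sphere (z : 'rV[R[i]]_n) (hz : norm2 z = 1) : sphere :=
  SigSub (mem_set hz : z \in unit_sphere).

Lemma to_sphereK z hz : sphere_val (@to_sphere z hz) = z.
Proof. by []. Qed.

Lemma continuous_sphere_val : continuous sphere_val.
Proof. exact: initial_continuous. Qed.

Lemma continuous_coord (j : 'I_n) : continuous (fun z : 'rV[R[i]]_n => z 0 j).
Proof. exact: coord_continuous. Qed.

Lemma norm2_eq1 z : norm2 z = 1 <-> \sum_(j < n) normc (z 0 j) ^+ 2 = 1.
Proof.
have ge0 : 0 <= \sum_(j < n) normc (z 0 j) ^+ 2.
  by apply: sumr_ge0 => j _; exact: sqr_ge0.
split => [z1|]; last by rewrite /norm2 => ->; rewrite sqrtr1.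
by rewrite -(sqr_sqrtr ge0) -/(norm2 z) z1 expr1n.
Qed.

End sphere.
Arguments unit_sphere : clear implicits.
Arguments sphere_val {R n}.

Section sphere_compact.
Context {R : realType}.

Let mkC (p : R * R) : R[i] := p.1 +i* p.2.

Let continuous_mkC : continuous mkC.
Proof.
move=> [a b]; apply/(@cvgrPdist_lt _ _ _ (nbhs (a, b))) => e.
case: e => e e' /[!ltcE]/= /andP[/eqP-> e0].
have e20 : 0 < e / 2 by rewrite divr_gt0.
exists (ball a (e / 2), ball b (e / 2)).
  by split; exact: nbhsx_ballx.
move=> [c d] /= [ac bd]; rewrite [X in `|X|](_ : _ = (a - c) +i* (b - d)) //.
rewrite normc_normr ltcR (le_lt_trans (normc_le_ReIm _))//= (splitr e).
by rewrite ltrD.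
Qed.

Lemma continuous_normc : continuous (@normc R).
Proof.
move=> z.
have -> : @normc R = (@Num.sqrt R) \o (fun z => Re z ^+ 2 + Im z ^+ 2).
  by apply/funext => w; rewrite normc_sqrt.
apply: continuous_comp; last exact: sqrt_continuous.
apply: (@cvgD _ _ _ (nbhs z)).
  apply: (@continuous_comp _ _ _ (@Re R) (fun x : R => x ^+ 2)).
    exact: continuous_Re.
  exact: exprn_continuous.
apply: (@continuous_comp _ _ _ (@Im R) (fun x : R => x ^+ 2)).
  exact: continuous_Im.
exact: exprn_continuous.
Qed.

Lemma closed_unit_sphere n : closed (unit_sphere R n).
Proof.
pose h (j : 'I_n) (z : 'rV[R[i]]_n) : R := normc (z 0 j) ^+ 2.
have hc : continuous (\sum_(j < n) h j).
  elim/big_ind : _ => [|f g cf cg z|j _].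
  - exact: cst_continuous.
  - by apply: (@cvgD _ _ _ (nbhs z)); [exact: cf|exact: cg].
  move=> z; apply: (@continuous_comp _ _ _ (fun z : 'rV[R[i]]_n => normc (z 0 j))
    (fun x : R => x ^+ 2)); last exact: exprn_continuous.
  apply: (@continuous_comp _ _ _ (fun z : 'rV[R[i]]_n => z 0 j) (@normc R)).
    exact: continuous_coord.
  exact: continuous_normc.
have -> : unit_sphere R n = (\sum_(j < n) h j) @^-1` [set 1].
  by rewrite fct_sumE; apply/seteqP; split => z /norm2_eq1.
apply: preimage_closed => [z _|]; [exact: hc|exact: closed_eq].
Qed.

Lemma normc_coord_le1 n (z : 'rV[R[i]]_n) j : norm2 z = 1 -> normc (z 0 j) <= 1.
Proof.
move=> /norm2_eq1 z1; rewrite -(@ler_pXn2r _ 2)// ?nnegrE ?normc_ge0//.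
rewrite expr1n -z1 (bigD1 j)//= lerDl sumr_ge0// => k _; exact: sqr_ge0.
Qed.

Lemma compact_unit_sphere n : compact (unit_sphere R n).
Proof.
pose I := `[-1, 1]%classic : set R.
have cI : compact (mkC @` (I `*` I)).
  apply: continuous_compact; first exact: continuous_subspaceT.
  by apply: compact_setX; exact: segment_compact.
apply: (subclosed_compact (@closed_unit_sphere n)
  (@rV_compact _ _ (fun=> mkC @` (I `*` I)) (fun=> cI))).
move=> z z1 /= j; exists (Re (z 0 j), Im (z 0 j)); last by case: (z 0 j).
have zj := normc_coord_le1 j z1.
split; rewrite /I /= in_itv/= -ler_norml.
  exact: le_trans (normr_Re_le _) zj.
exact: le_trans (normr_Im_le _) zj.
Qed.

Lemma compact_sphere n : compact [set: sphere R n].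
Proof.
move=> F FF _.
pose G := (@sphere_val R n) @ F.
have GF : ProperFilter G by exact: fmap_proper_filter.
have [|z [z1 clz]] := @compact_unit_sphere n G GF.
  by rewrite /G /fmap /nbhs/=; apply: filterE => z; exact: sphere_valP.
exists (to_sphere z1); split => // A B FA.
rewrite nbhsE /= => -[C [[D oD DC]] Cz CB].
have [||w [[u Au <-] Dw]] := clz (@sphere_val R n @` A) D.
- rewrite /G /fmap /nbhs/=; apply: filterS FA => u Au; by exists u.
- by apply: open_nbhs_nbhs; split => //; move: Cz; rewrite -DC.
- by exists u; split => //; apply: CB; rewrite -DC.
Qed.

Lemma norm2_delta n : norm2 (delta_mx 0 ord0 : 'rV[R[i]]_n.+1) = 1.
Proof.
apply/norm2_eq1; rewrite big_ord_recl/= big1 => [|j _].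
  by rewrite mxE !eqxx ComplexField.Normc.normc1 expr1n addr0.
by rewrite mxE /= expr0n/= addr0 sqrtr0 expr0n.
Qed.

End sphere_compact.

Section continuous_functions.
Context (R : realType) (n : nat).

Definition cts_pred : {pred (sphere R n -> R[i])} := mem [set f | continuous f].

Record csphere := CSphere {
  csphere_fun :> sphere R n -> R[i];
  _ : csphere_fun \in cts_pred }.

HB.instance Definition _ := [isSub for csphere_fun].
HB.instance Definition _ := [Choice of csphere by <:].

Let cts_submod_closed : GRing.submod_closed cts_pred.
Proof.
split; first by apply/mem_set => z; exact: cst_continuous.
move=> a f g /set_mem/= cf /set_mem/= cg; apply/mem_set => z /=.
apply: (@cvgD _ _ _ (nbhs z)); last exact: cg.
by apply: (@cvgZl_tmp _ _ _ (nbhs z)); exact: cf.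
Qed.

HB.instance Definition _ := GRing.isSubmodClosed.Build _ _ cts_pred
  cts_submod_closed.

HB.instance Definition _ := [SubChoice_isSubLmodule of csphere by <:].

Definition to_csphere (f : sphere R n -> R[i]) (cf : continuous f) : csphere :=
  CSphere (mem_set cf).

Lemma csphereP (f : csphere) : continuous f.
Proof. exact: (set_mem (valP f)). Qed.

Lemma csphere_eqP (f g : csphere) : f = g <-> f =1 g.
Proof. by split=> [->//|fg]; exact/val_inj/funext. Qed.

Definition sup_norm (f : csphere) : R := sup (range (@normc R \o f)).

Lemma has_ubound_normc (f : csphere) : has_ubound (range (@normc R \o f)).
Proof.
have cf : compact (range (@normc R \o f)).
  apply: continuous_compact; last exact: compact_sphere.
  apply: continuous_subspaceT => z; apply: continuous_comp.
    exact: csphereP.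
  exact: continuous_normc.
have [M [Mreal hM]] := compact_bounded cf.
exists (M + 1) => _ [z _ <-].
by apply: le_trans (hM (M + 1) _ _ _); [exact: ler_norm|rewrite ltrDl|exists z].
Qed.

Lemma sup_norm_ub (f : csphere) z : normc (f z) <= sup_norm f.
Proof. by apply: ub_le_sup; [exact: has_ubound_normc|exists z]. Qed.

Lemma sup_norm_ge0 (f : csphere) : 0 <= sup_norm f.
Proof.
have [[z _]|/set0P/negP/negPn/eqP s0] := pselect ([set: sphere R n] !=set0).
  exact: le_trans (normc_ge0 _) (sup_norm_ub f z).
by rewrite /sup_norm s0 image_set0 sup0.
Qed.

Lemma sup_norm_le (f : csphere) (M : R) : 0 <= M ->
  sup_norm f <= M <-> forall z, normc (f z) <= M.
Proof.
move=> M0; split=> [fM z|fM]; first exact: le_trans (sup_norm_ub f z) fM.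
have [[z _]|/set0P/negP/negPn/eqP s0] := pselect ([set: sphere R n] !=set0).
  by apply: ge_sup; [exists (normc (f z)), z|move=> _ [w _ <-]; exact: fM].
by rewrite /sup_norm s0 image_set0 sup0.
Qed.

(* The norm of a normed module over R[i] takes its values in R[i]. *)
Let norm (f : csphere) : R[i] := (sup_norm f)%:C.

Let normD f g : norm (f + g) <= norm f + norm g.
Proof.
rewrite -rmorphD lecR; apply/sup_norm_le; first by rewrite addr_ge0 ?sup_norm_ge0.
move=> z; apply: le_trans (le_normcD _ _) _.
by rewrite lerD ?sup_norm_ub.
Qed.

Let normZ (a : R[i]) f : norm (a *: f) = `|a| * norm f.
Proof.
rewrite normc_normr -rmorphM; congr (_%:C).
have le b g : sup_norm (b *: g) <= normc b * sup_norm g.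
  apply/sup_norm_le; first by rewrite mulr_ge0 ?normc_ge0 ?sup_norm_ge0.
  move=> z; rewrite [_ z]/(b * g z) ComplexField.Normc.normcM.
  by rewrite ler_wpM2l ?normc_ge0 ?sup_norm_ub.
apply/eqP; rewrite eq_le le /=.
have [->|a0] := eqVneq a 0.
  by rewrite ComplexField.Normc.normc0 mul0r sup_norm_ge0.
have na0 : 0 < normc a.
  by rewrite lt_neqAle normc_ge0 andbT eq_sym; apply: contra_neq a0;
    exact: ComplexField.Normc.eq0_normc.
rewrite mulrC -ler_pdivlMr// mulrC -ComplexField.Normc.normcV.
by apply: le_trans (le _ _); rewrite scalerA mulVf// scale1r.
Qed.

Let norm0_eq0 f : norm f = 0 -> f = 0.
Proof.
move=> /complexI f0; apply/csphere_eqP => z.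
apply: ComplexField.Normc.eq0_normc; apply/eqP.
by rewrite eq_le normc_ge0 andbT -f0 sup_norm_ub.
Qed.

HB.instance Definition _ := Lmodule_isNormed.Build R[i] csphere
  normD normZ norm0_eq0.

Lemma csphere_normE (f : csphere) : `|f| = (sup_norm f)%:C.
Proof. by []. Qed.

End continuous_functions.

Section complex_L1.
Context d (T : measurableType d) (R : realType).
Variable mu : {measure set T -> \bar R}.
Implicit Types f g h : T -> R[i].

Definition cmeasurable f :=
  measurable_fun setT (@Re R \o f) /\
  measurable_fun setT (@Im R \o f).

Definition cintegrable f :=
  cmeasurable f /\ (\int[mu]_x (normc (f x))%:E < +oo)%E.

Lemma measurable_normc f : cmeasurable f ->
  measurable_fun setT (@normc R \o f).
Proof.
move=> [mre mim].
have -> : @normc R \o f = (@Num.sqrt R) \o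
    (fun x => Re (f x) ^+ 2 + Im (f x) ^+ 2).
  by apply/funext => x; exact: normc_sqrt.
apply: measurableT_comp.
  exact: (continuous_measurable_fun (@sqrt_continuous R)).
by apply: measurable_funD; exact: measurable_funX.
Qed.

Lemma cmeasurableB f g : cmeasurable f -> cmeasurable g ->
  cmeasurable (f \- g).
Proof.
move=> [fr fi] [gr gi]; split.
  rewrite (_ : _ \o _ = (@Re R \o f) \- (@Re R \o g)).
    exact: measurable_funB.
  by apply/funext => x /=; case: (f x) (g x) => ? ? [].
rewrite (_ : _ \o _ = (@Im R \o f) \- (@Im R \o g)).
  exact: measurable_funB.
by apply/funext => x /=; case: (f x) (g x) => ? ? [].
Qed.

Definition L1dist f g : \bar R := \int[mu]_x (normc (f x - g x))%:E.

Let measurable_dist f g : cmeasurable f -> cmeasurable g ->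
  measurable_fun setT (fun x => (normc (f x - g x))%:E).
Proof.
move=> mf mg; apply/measurable_EFinP.
exact: (measurable_normc (cmeasurableB mf mg)).
Qed.

Lemma L1dist_ge0 f g : (0 <= L1dist f g)%E.
Proof. by apply: integral_ge0 => x _; rewrite lee_fin normc_ge0. Qed.

Lemma L1dist_sym f g : L1dist f g = L1dist g f.
Proof. by apply: eq_integral => x _; rewrite normcB. Qed.

Lemma L1dist_triangle g f h : cmeasurable f -> cmeasurable g ->
  cmeasurable h -> (L1dist f h <= L1dist f g + L1dist g h)%E.
Proof.
move=> mf mg mh; rewrite /L1dist -ge0_integralD//.
- apply: ge0_le_integral => //.
  + by move=> x _; rewrite lee_fin normc_ge0.
  + exact: measurable_dist.
  + by apply: emeasurable_funD; exact: measurable_dist.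
  + move=> x _; rewrite lee_fin; apply: le_trans (le_normcD _ _).
    by rewrite addrA subrK.
- by move=> x _; rewrite lee_fin normc_ge0.
- exact: measurable_dist.
- by move=> x _; rewrite lee_fin normc_ge0.
- exact: measurable_dist.
Qed.

Lemma L1dist_fin_num f g : cintegrable f -> cintegrable g ->
  L1dist f g \is a fin_num.
Proof.
move=> [mf fi] [mg gi]; rewrite ge0_fin_numE ?L1dist_ge0//.
have m0 : cmeasurable (cst 0) by split; exact: measurable_cst.
apply: le_lt_trans (L1dist_triangle mf m0 mg) _.
have d0 h : L1dist h (cst 0) = (\int[mu]_x (normc (h x))%:E)%E.
  by apply: eq_integral => x _; rewrite /= subr0.
by rewrite (L1dist_sym (cst 0)) !d0 lte_add_pinfty.
Qed.

Lemma L1dist_eq0 f g : cmeasurable f -> cmeasurable g ->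
  L1dist f g = 0%E <-> f = g %[ae mu].
Proof.
move=> mf mg; have := ae_eq_integral_abs mu measurableT (measurable_dist mf mg).
rewrite /L1dist.
rewrite (eq_integral (fun x => (normc (f x - g x))%:E)); last first.
  by move=> x _; rewrite gee0_abs// lee_fin normc_ge0.
move=> ->; split; apply: filterS => x /= h _; have := h I.
  case=> /ComplexField.Normc.eq0_normc/eqP; rewrite subr_eq0 => /eqP//.
by move=> ->; rewrite subrr ComplexField.Normc.normc0.
Qed.

(* Lspace of the library only contains real-valued functions. *)
Record L1fun := L1Fun { L1fun_fun :> T -> R[i]; L1funP : cintegrable L1fun_fun }.

HB.instance Definition _ := gen_eqMixin L1fun.
HB.instance Definition _ := gen_choiceMixin L1fun.

Definition L1_ae_eq (f g : L1fun) : bool := `[< f = g %[ae mu] >].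

Let L1_ae_eq_refl : reflexive L1_ae_eq.
Proof. by move=> f; apply/asboolP; exact: ae_eq_refl. Qed.

Let L1_ae_eq_sym : symmetric L1_ae_eq.
Proof. by move=> f g; apply/idP/idP => /asboolP h; apply/asboolP/ae_eq_sym. Qed.

Let L1_ae_eq_trans : transitive L1_ae_eq.
Proof.
by move=> f g h /asboolP gf /asboolP fh; apply/asboolP/(ae_eq_trans gf fh).
Qed.

Canonical L1_ae_eq_equiv :=
  EquivRel L1_ae_eq L1_ae_eq_refl L1_ae_eq_sym L1_ae_eq_trans.

Local Open Scope quotient_scope.

Definition L1 : Type := {eq_quot L1_ae_eq}.
HB.instance Definition _ := Choice.on L1.
HB.instance Definition _ := EqQuotient.on L1.

Definition L1_pi (f : L1fun) : L1 := \pi_L1 f.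

Let dist (u v : L1) : R := fine (L1dist (repr u) (repr v)).

Let distE u v : (dist u v)%:E = L1dist (repr u) (repr v).
Proof. by rewrite fineK// L1dist_fin_num//; exact: L1funP. Qed.

Let distxx u : dist u u = 0.
Proof.
by apply: EFin_inj; rewrite distE; apply/L1dist_eq0;
  [exact: (L1funP _).1|exact: (L1funP _).1|exact: ae_eq_refl].
Qed.

Let dist_positivity u v : dist u v = 0 -> u = v.
Proof.
move=> uv; rewrite -(reprK u) -(reprK v); apply/eqmodP/asboolP.
by apply/L1dist_eq0; [exact: (L1funP _).1|exact: (L1funP _).1|rewrite -distE uv].
Qed.

Let dist_sym u v : dist u v = dist v u.
Proof. by rewrite /dist L1dist_sym. Qed.

Let dist_triangle v u w : dist u w <= dist u v + dist v w.
Proof.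
by rewrite -lee_fin EFinD !distE; apply: L1dist_triangle; exact: (L1funP _).1.
Qed.

HB.instance Definition _ := isMetric.Build R L1
  distxx dist_positivity dist_sym dist_triangle.

Lemma L1_mdistE (f g : L1fun) :
  (mdist (L1_pi f) (L1_pi g))%:E = (\int[mu]_x (normc (f x - g x))%:E)%E.
Proof.
rewrite [LHS]distE -/(L1dist f g).
have rE (h : L1fun) : L1dist (repr (L1_pi h)) h = 0%E.
  apply/L1dist_eq0; [exact: (L1funP _).1|exact: (L1funP _).1|].
  by apply/asboolP; have /eqmodP := reprK (L1_pi h).
have m := fun h : L1fun => (L1funP h).1.
apply/eqP; rewrite eq_le; apply/andP; split.
  apply: le_trans (L1dist_triangle (m _) (m f) (m _)) _; rewrite rE add0e.
  apply: le_trans (L1dist_triangle (m _) (m g) (m _)) _.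
  by rewrite (L1dist_sym g) rE adde0.
apply: le_trans (L1dist_triangle (m _) (m (repr (L1_pi f))) (m _)) _.
rewrite (L1dist_sym f) rE add0e.
apply: le_trans (L1dist_triangle (m _) (m (repr (L1_pi g))) (m _)) _.
by rewrite rE adde0.
Qed.

End complex_L1.

HB.instance Definition _ (R : realType) (n : nat) :=
  isPointed.Build (sphere R n.+1) (to_sphere (@norm2_delta R n)).

Definition borel_sphere (R : realType) (n : nat) :=
  g_sigma_algebraType (@open (sphere R n)).

Lemma continuous_borel_measurable (R : realType) (n : nat)
    (f : sphere R n.+1 -> R) :
  continuous f -> measurable_fun setT (f : borel_sphere R n.+1 -> R).
Proof.
move=> /continuousP cf; apply: (measurability _ (RGenOpens.measurableE R)).
move=> _ [_ [a [b ->] <-]]; rewrite setTI; apply: sub_sigma_algebra.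
exact/cf/interval_open.
Qed.

Section inclusion.
Context (R : realType) (n : nat).
Variable sigma : probability (borel_sphere R n.+1) R.

Lemma csphere_integrable (f : csphere R n.+1) :
  cintegrable sigma (f : borel_sphere R n.+1 -> R[i]).
Proof.
have mf : cmeasurable (f : borel_sphere R n.+1 -> R[i]).
  split; apply: continuous_borel_measurable => z.
    by apply: continuous_comp; [exact: csphereP|exact: continuous_Re].
  by apply: continuous_comp; [exact: csphereP|exact: continuous_Im].
split=> //; apply: (@le_lt_trans _ _ (\int[sigma]_x (sup_norm f)%:E)%E).
  apply: ge0_le_integral => //.
  - by move=> x _; rewrite lee_fin normc_ge0.
  - by apply/measurable_EFinP; exact: measurable_normc.
  - by move=> x _; rewrite lee_fin; exact: sup_norm_ub.
rewrite integral_cst// [X in (_ * X)%E](_ : _ = 1%E) ?mule1 ?ltry//.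
exact: probability_setT.
Qed.

Definition L1_incl (f : csphere R n.+1) : L1 sigma :=
  L1_pi (L1Fun (csphere_integrable f)).

Lemma L1_incl_mdistE (f g : csphere R n.+1) :
  (mdist (L1_incl f) (L1_incl g))%:E =
  (\int[sigma]_z (normc (f z - g z))%:E)%E.
Proof. exact: L1_mdistE. Qed.

(* The set on the left is the rotated set A U. Invariance under the unitary
   group alone already determines a Borel probability measure on the sphere, so
   this is the same measure as the one invariant under all real rotations. *)
Definition rotation_invariant := forall U : 'M[R[i]]_n.+1, U \is unitarymx ->
  forall A : set (borel_sphere R n.+1), measurable A ->
  sigma [set w | exists2 z, A z & sphere_val w = sphere_val z *m U] = sigma A.

End inclusion.

Section spherical_harmonics.
Context (R : realType) (n : nat).
Local Notation C := R[i].
Implicit Types (f : 'rV[C]_n -> C) (z v : 'rV[C]_n) (p q : nat).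

(* Derivative at z in direction v with respect to a real increment. *)
Definition real_derive f v z : C :=
  derive1 (fun t : R => Re (f (z + t%:C *: v))) 0 +i*
  derive1 (fun t : R => Im (f (z + t%:C *: v))) 0.

Definition partial_z (j : 'I_n) f z : C :=
  2^-1 * (real_derive f (delta_mx 0 j) z
          - 'i%C * real_derive f ('i%C *: delta_mx 0 j) z).

Definition partial_zbar (j : 'I_n) f z : C :=
  2^-1 * (real_derive f (delta_mx 0 j) z
          + 'i%C * real_derive f ('i%C *: delta_mx 0 j) z).

Definition laplacian f z : C := \sum_(j < n) partial_z j (partial_zbar j f) z.

(* The entries of a multi-index of length p are at most p. *)
Definition multi_index p := {a : {ffun 'I_n -> 'I_p.+1} | (\sum_j (a j : nat) == p)%N}.

Definition bimonomial p q (a : multi_index p) (b : multi_index q) z : C :=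
  \prod_(j < n) (z 0 j ^+ val a j * (z 0 j)^*%C ^+ val b j).

Definition bihomogeneous p q : set ('rV[C]_n -> C) :=
  [set f | exists c : multi_index p -> multi_index q -> C,
    forall z, f z = \sum_a \sum_b c a b * bimonomial a b z].

Definition harmonic p q : set ('rV[C]_n -> C) :=
  [set f | bihomogeneous p q f /\ forall z, laplacian f z = 0].

Definition spherical_harmonic p q : set (csphere R n) :=
  [set g | exists2 f, harmonic p q f & forall w, g w = f (sphere_val w)].

End spherical_harmonics.

Section linear.
Context (K : numFieldType).

Definition linear_span (V : lmodType K) (A : set V) : set V :=
  [set x | exists (m : nat) (c : 'I_m -> K) (v : 'I_m -> V),
    (forall i, A (v i)) /\ x = \sum_(i < m) c i *: v i].

Definition linear_subspace (V : lmodType K) (X : set V) :=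
  X 0 /\ forall (a : K) x y, X x -> X y -> X (a *: x + y).

(* Compactness of the restriction to X of T, as a map on a normed space. *)
Definition compact_operator (V : normedModType K) (W : topologicalType)
    (X : set V) (T : V -> W) :=
  precompact (T @` (X `&` [set x | `|x| <= 1])).

End linear.

Definition spherical_harmonics_span (R : realType) (n : nat) (J : set nat)
    (q : nat) : set (csphere R n) :=
  closure (linear_span (\bigcup_(p in J) @spherical_harmonic R n p q)).

(* Main.v *)
(* For [p > 0] take a maximal family of unit vectors [w] whose complex lines are
   separated at distance [1 / (5 sqrt p)]. Each [w] carries a pair [u = w + s w'],
   [v = w' - s w], with [w'] a unit vector orthogonal to [w] and [s] of order
   [1 / sqrt p]; as [u] and [v] are orthogonal,
   [sqrt p ^ q * <z, u> ^ p * conj <z, v> ^ q] is harmonic of bidegree [(p, q)].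
   It decays like a Gaussian of width [1 / sqrt p] around the line of [w], so
   separation bounds the sum of the moduli over the family uniformly in [p], while
   maximality bounds the sum of the squared moduli from below. Suitable signs
   therefore give [f_p] in H_{p,q} with [|f_p| <= 1] and with L1 norm bounded below.
   These [f_p] are separated in L1: if [a ^ (p - p') = -1] then, up to a unimodular
   factor, rotation by [a] turns [f_p - f_p'] into [f_p + f_p'], and
   [|f_p - f_p'| + |f_p + f_p'| >= 2 |f_p|]. *)

From HB Require Import structures.
Require Import Defs.
From mathcomp Require Import all_boot all_order all_algebra.
From mathcomp Require Import all_classical all_reals all_analysis.
From mathcomp Require Import finmap measurable_realfun complex ring lra.

Set Implicit Arguments.
Unset Strict Implicit.
Unset Printing Implicit Defensive.

Import Order.TTheory GRing.Theory Num.Theory.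

Local Open Scope classical_set_scope.
Local Open Scope ring_scope.

Local Notation Re := complex.Re.
Local Notation Im := complex.Im.
Local Notation normc := ComplexField.Normc.normc.

(** * Sums over separated points, compared with sums over an integer grid *)

Section grid.
Context {R : realType}.

(** This function is odd and bounded by 1, and four times its increment over a unit cell with
    integer endpoints dominates [(1 + x ^+ 2)^-1] at the left endpoint, so sums of these weights
    telescope. *)
Let h (x : R) := x / (1 + `|x|).

Let h_le1 x : `|h x| <= 1.
Proof.
have p : 0 < 1 + `|x| by rewrite ltr_pwDl.
by rewrite /h normrM normfV (gtr0_norm p) ler_pdivrMr// mul1r lerDr.
Qed.

Let weight_le_h (k : nat) : (1 + k%:R ^+ 2)^-1 <= 4 * (h (k%:R + 1) - h k%:R).
Proof.
have k0 : 0 <= k%:R :> R by [].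
rewrite /h !ger0_norm ?addr_ge0//; set x := k%:R.
have -> : 4 * ((x + 1) / (1 + (x + 1)) - x / (1 + x)) =
    ((1 + x) * (2 + x) / 4)^-1.
  field; rewrite /x; do ![apply/andP; split]; apply/negP => /eqP; lra.
have {}k0 : 0 <= x by [].
by rewrite lef_pV2 ?posrE; nra.
Qed.

Let weight_le_telescope (t L : nat) :
  (1 + (t%:R - L%:R) ^+ 2)^-1 <= 4 * (h (t.+1%:R - L%:R) - h (t%:R - L%:R)).
Proof.
have [Lt|tL] := leqP L t.
  have -> : t.+1%:R - L%:R = (t - L)%:R + 1 :> R.
    by rewrite natrB// -natr1 addrAC.
  by rewrite -natrB//; exact: weight_le_h.
(* As [h] is odd, the cell from [- (k + 1)] to [- k] has the same increment as the one from [k] to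
   [k + 1]. *)
set k := (L - t.+1)%N.
have -> : t.+1%:R - L%:R = - k%:R :> R by rewrite /k natrB// opprB.
have -> : t%:R - L%:R = - (k%:R + 1) :> R.
  by rewrite /k natrB// -natr1; lra.
have hN x : h (- x) = - h x by rewrite /h normrN mulNr.
rewrite !hN opprK [- _ + _]addrC; apply: le_trans (weight_le_h k).
have : 0 <= k%:R :> R by [].
by rewrite lef_pV2 ?posrE; nra.
Qed.

Lemma sum_inv_sqr_le8 (N L : nat) :
  \sum_(t < N) (1 + (t%:R - L%:R) ^+ 2)^-1 <= 8 :> R.
Proof.
apply: (@le_trans _ _ (\sum_(0 <= t < N)
    4 * (h (t.+1%:R - L%:R) - h (t%:R - L%:R)))).
  by rewrite big_mkord; apply: ler_sum => t _; exact: weight_le_telescope.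
rewrite -mulr_sumr (telescope_sumr (fun t => h (t%:R - L%:R)))//.
have /ler_normlP[_ h1] := h_le1 (N%:R - L%:R).
by have /ler_normlP[h2 _] := h_le1 (0%:R - L%:R); lra.
Qed.

(* Each unit cell of the grid contains at most one of the points. *)
Lemma sum_separated_le (I D : finType) (x : I -> D -> R) :
  (forall i i', i != i' -> exists j, 1 <= `|x i j - x i' j|) ->
  \sum_i \prod_j (1 + x i j ^+ 2)^-1 <= 24 ^+ #|D|.
Proof.
move=> sep.
have [L xL] : exists L : nat, forall i j, `|x i j| <= L%:R.
  exists (\max_(ij : I * D) Num.truncn `|x ij.1 ij.2|).+1%N => i j.
  apply/ltW/(lt_le_trans (truncnS_gt _)).
  by rewrite ler_nat ltnS (leq_bigmax (i, j)).
(* Shifted by [L], every coordinate lies between 0 and [2 * L], so [N] unit cells suffice. *)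
pose N := (2 * L).+1.
have x0 i j : 0 <= x i j + L%:R by have /ler_normlP[? ?] := xL i j; lra.
have tN i j : (Num.truncn (x i j + L%:R) < N)%N.
  rewrite /N ltnS -(ler_nat R); have := x0 i j; rewrite -truncn_le => /le_trans; apply.
  by have /ler_normlP[? ?] := xL i j; rewrite natrM; lra.
pose c i : {ffun D -> 'I_N} := [ffun j => Ordinal (tN i j)].
have cP i j : (c i j)%:R <= x i j + L%:R < (c i j)%:R + 1.
  by rewrite ffunE/= natr1 truncn_itv.
have c_inj : injective c.
  move=> i i' ii'; apply/eqP/negPn/negP => /sep[j].
  rewrite leNgt => /negP; apply.
  by have := cP i j; have := cP i' j; rewrite ii' ltr_norml; lra.
(* Moving a coordinate to the left end of its unit cell changes the weight by a factor of at most
   3. *)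
pose g (t : 'I_N) : R := 3 * (1 + (t%:R - L%:R) ^+ 2)^-1.
have g0 t : 0 <= g t by rewrite mulr_ge0// invr_ge0 addr_ge0// sqr_ge0.
apply: (@le_trans _ _ (\sum_i \prod_j g (c i j))).
  apply: ler_sum => i _; apply: ler_prod => j _.
  rewrite invr_ge0 addr_ge0 ?sqr_ge0//= /g -[3]invrK -invfM.
  rewrite lef_pV2 ?posrE ?mulr_gt0 ?ltr_pwDl ?sqr_ge0//.
  have /andP[d0 d1] := cP i j.
  set t := (c i j)%:R - L%:R; have {}d0 : 0 <= x i j - t by rewrite /t; lra.
  have {}d1 : x i j - t <= 1 by rewrite /t; lra.
  have : 0 <= (x i j - t) * (1 - (x i j - t)) by rewrite mulr_ge0// subr_ge0.
  by have := sqr_ge0 (3 * x i j - t); nra.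
(* Distinct points have distinct cells, so the sum is part of one over all cells. That sum factors
   into one-dimensional sums of size at most [3 * 8 = 24]. *)
apply: (@le_trans _ _ (\sum_(f : {ffun D -> 'I_N}) \prod_j g (f j))).
  rewrite -(big_imset (fun f : {ffun D -> 'I_N} => \prod_j g (f j)))/=; last first.
    by move=> ? ? _ _ /c_inj.
  rewrite big_mkcond/=; apply: ler_sum => f _; case: ifP => // _.
  exact: prodr_ge0.
rewrite -(bigA_distr_bigA (fun=> g)) prodr_const.
apply: lerXn2r; rewrite ?nnegrE ?sumr_ge0//.
by rewrite -mulr_sumr; have := sum_inv_sqr_le8 N L; lra.
Qed.

End grid.


(** * Identities for the complex modulus *)

Section hermitian.
Context {R : realType}.
Local Notation C := R[i].
Implicit Types a b c : C.

Lemma sqr_normc a : normc a ^+ 2 = Re a ^+ 2 + Im a ^+ 2.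
Proof. by rewrite normc_sqrt sqr_sqrtr// addr_ge0 ?sqr_ge0. Qed.

Lemma normcX a k : normc (a ^+ k) = normc a ^+ k.
Proof.
elim: k => [|k IH]; first by rewrite !expr0 ComplexField.Normc.normc1.
by rewrite !exprS ComplexField.Normc.normcM IH.
Qed.

Lemma normc_conj a : normc (conjc a) = normc a.
Proof. by rewrite !normc_sqrt; case: a => x y /=; rewrite sqrrN. Qed.

Lemma normc_real (x : R) : 0 <= x -> normc x%:C%C = x.
Proof. by move=> x0; rewrite normc_sqrt/= expr0n addr0 sqrtr_sqr ger0_norm. Qed.

Lemma mulc_conj a : a * conjc a = (normc a ^+ 2)%:C%C.
Proof.
rewrite sqr_normc; case: a => x y; apply/eqP; rewrite eq_complex /=.
by apply/andP; split; apply/eqP; ring.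
Qed.

Lemma sqr_normcB a b :
  normc (a - b) ^+ 2 = normc a ^+ 2 + normc b ^+ 2 - 2 * Re (a * conjc b).
Proof. by rewrite !sqr_normc; case: a b => [x y] [z t] /=; ring. Qed.

Lemma sqr_normcD a b :
  normc (a + b) ^+ 2 = normc a ^+ 2 + normc b ^+ 2 + 2 * Re (a * conjc b).
Proof. by rewrite !sqr_normc; case: a b => [x y] [z t] /=; ring. Qed.

Lemma ReD a b : Re (a + b) = Re a + Re b.
Proof. by case: a b => [x y] [z t]. Qed.

Lemma ImD a b : Im (a + b) = Im a + Im b.
Proof. by case: a b => [x y] [z t]. Qed.

Lemma Re_sum I (r : seq I) (F : I -> C) :
  Re (\sum_(i <- r) F i) = \sum_(i <- r) Re (F i).
Proof. exact: (big_morph _ ReD). Qed.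

Lemma unimodular_align a : exists2 b, normc b = 1 & Re (a * conjc b) = normc a.
Proof.
have [->|a0] := eqVneq a 0.
  by exists 1; rewrite ?ComplexField.Normc.normc1// mul0r ComplexField.Normc.normc0.
have na0 : normc a != 0.
  by apply: contra_neq a0; exact: ComplexField.Normc.eq0_normc.
exists ((normc a)^-1%:C%C * a).
  rewrite ComplexField.Normc.normcM normc_real ?mulVf//.
  by rewrite invr_ge0 normc_ge0.
set k := (normc a)^-1.
have -> : Re (a * conjc (k%:C%C * a)) = k * normc a ^+ 2.
  by rewrite sqr_normc; case: (a) => x y /=; ring.
by rewrite expr2 mulKf.
Qed.

End hermitian.

(** * The Hermitian inner product, Bessel's inequality and orthogonal unit vectors *)

Section inner_product.
Context {R : realType} {n : nat}.
Local Notation C := R[i].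
Implicit Types (a b : C) (x y z u v w : 'rV[C]_n).

Definition ip x y : C := \sum_j x 0 j * conjc (y 0 j).

Definition nsq x : R := \sum_j normc (x 0 j) ^+ 2.

(** Since [ip] is antilinear in its second argument, [ip v z] is the conjugate of [ip z v]: the wave
    has degree [p] in [z] and degree [q] in its conjugate. *)
Definition plane_wave (c : C) p q u v z : C := c * (ip z u ^+ p * ip v z ^+ q).

(** For the tilted pairs [u], [v] used below, [ip v z] has order [1 / sqrt p] near the centre; the
    coefficient compensates for its [q]-th power. *)
Definition wave (p q : nat) u v z : C :=
  plane_wave (Num.sqrt p%:R ^+ q)%:C%C p q u v z.

Lemma ipDl x y z : ip (x + y) z = ip x z + ip y z.
Proof. by rewrite -big_split; apply: eq_bigr => j _; rewrite mxE mulrDl. Qed.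

Lemma ipZl a x z : ip (a *: x) z = a * ip x z.
Proof. by rewrite mulr_sumr; apply: eq_bigr => j _; rewrite mxE mulrA. Qed.

Lemma ip_conj x y : conjc (ip x y) = ip y x.
Proof.
by rewrite rmorph_sum; apply: eq_bigr => j _; rewrite rmorphM/= conjcK mulrC.
Qed.

Lemma ipDr x y z : ip x (y + z) = ip x y + ip x z.
Proof. by rewrite -ip_conj ipDl rmorphD/= !ip_conj. Qed.

Lemma ipZr a x z : ip x (a *: z) = conjc a * ip x z.
Proof. by rewrite -ip_conj ipZl rmorphM/= ip_conj. Qed.

Lemma ipNr x z : ip x (- z) = - ip x z.
Proof. by rewrite -scaleN1r ipZr rmorphN1 mulN1r. Qed.

Lemma ipxx x : ip x x = (nsq x)%:C%C.
Proof. by rewrite rmorph_sum; apply: eq_bigr => j _; rewrite mulc_conj. Qed.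

Lemma nsq_ge0 x : 0 <= nsq x.
Proof. by apply: sumr_ge0 => j _; exact: sqr_ge0. Qed.

Lemma nsqB x y : nsq (x - y) = nsq x + nsq y - 2 * Re (ip x y).
Proof.
rewrite Re_sum mulr_sumr -sumrN -!big_split/=; apply: eq_bigr => j _.
by rewrite !mxE sqr_normcB.
Qed.

Lemma nsqD x y : nsq (x + y) = nsq x + nsq y + 2 * Re (ip x y).
Proof.
rewrite Re_sum mulr_sumr -!big_split/=; apply: eq_bigr => j _.
by rewrite !mxE sqr_normcD.
Qed.

Lemma nsqZ a x : nsq (a *: x) = normc a ^+ 2 * nsq x.
Proof.
rewrite mulr_sumr; apply: eq_bigr => j _.
by rewrite mxE ComplexField.Normc.normcM exprMn.
Qed.

(** The squared norm of [z] minus its projection to the plane of [w] and [w'] is nonnegative. *)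
Lemma bessel2 z w w' : nsq z = 1 -> nsq w = 1 -> nsq w' = 1 -> ip w w' = 0 ->
  normc (ip z w) ^+ 2 + normc (ip z w') ^+ 2 <= 1.
Proof.
move=> z1 w1 w'1 ww'; have := nsq_ge0 (z - (ip z w *: w + ip z w' *: w')).
rewrite nsqB nsqD !nsqZ z1 w1 w'1 !mulr1 ipDr !ipZr ipZl ww' !mulr0/=.
rewrite ![conjc _ * _]mulrC !mulc_conj -rmorphD/=; lra.
Qed.

Lemma normc_ip_le1 z w : nsq z = 1 -> nsq w = 1 -> normc (ip z w) <= 1.
Proof.
move=> z1 w1; have := nsq_ge0 (z - ip z w *: w).
rewrite nsqB nsqZ z1 w1 mulr1 ipZr [conjc _ * _]mulrC mulc_conj/=.
by have := normc_ge0 (ip z w); nra.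
Qed.

End inner_product.

(** Dimension at least 2 enters here: a suitable vector is found in the plane of the first two
    coordinates and then normalized. *)
Lemma exists_orthonormal (R : realType) n (w : 'rV[R[i]]_n.+2) :
  exists2 w', nsq w' = 1 & ip w w' = 0.
Proof.
pose i0 : 'I_n.+2 := ord0; pose i1 : 'I_n.+2 := lift ord0 ord0.
suff [x x0 wx] : exists2 x, nsq x != 0 & ip w x = 0.
  exists ((Num.sqrt (nsq x))^-1%:C%C *: x); last by rewrite ipZr wx mulr0.
  rewrite nsqZ normc_real ?invr_ge0 ?sqrtr_ge0// exprVn sqr_sqrtr ?nsq_ge0//.
  by rewrite mulVf.
have [w0|w0] := eqVneq (w 0 i0) 0.
  exists (delta_mx 0 i0).
    rewrite /nsq (bigD1 i0)//= mxE !eqxx big1 ?addr0 => [|j /negPf ji].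
      by rewrite ComplexField.Normc.normc1 expr1n oner_eq0.
    by rewrite mxE ji andbF ComplexField.Normc.normc0 expr0n.
  rewrite /ip (bigD1 i0)//= w0 mul0r big1 ?addr0// => j /negPf ji.
  by rewrite mxE ji andbF conjc0 mulr0.
exists (conjc (w 0 i0) *: delta_mx 0 i1 - conjc (w 0 i1) *: delta_mx 0 i0).
  rewrite /nsq (bigD1 i1)//= !mxE !eqxx/= mulr0 subr0 mulr1 normc_conj.
  apply/negP; rewrite paddr_eq0 ?sqr_ge0//; last first.
    by apply: sumr_ge0 => j _; exact: sqr_ge0.
  move=> /andP[+ _].
  by rewrite sqrf_eq0 => /eqP/ComplexField.Normc.eq0_normc /eqP; rewrite (negPf w0).
rewrite ipDr ipNr !ipZr !conjcK.
have ipd k : ip w (delta_mx 0 k) = w 0 k.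
  rewrite /ip (bigD1 k)//= mxE !eqxx conjc1 mulr1 big1 ?addr0// => j /negPf jk.
  by rewrite mxE jk andbF conjc0 mulr0.
by rewrite !ipd mulrC subrr.
Qed.

(** * Gaussian sums over projectively separated unit vectors *)

(** Each of the [n * 2] real coordinates contributes 24 from the grid bound and [800 * n ^ 2] from
    comparing a Gaussian with [(1 + x ^+ 2)^-1]. *)
Definition packing_constant (R : realType) (n : nat) : R :=
  (800 * n%:R ^+ 2 * 24) ^+ (n * 2).

Lemma packing_constant_ge0 R n : 0 <= packing_constant R n.
Proof.
apply/exprn_ge0/mulr_ge0; last exact: ler0n.
by apply: mulr_ge0; [exact: ler0n|apply/exprn_ge0/ler0n].
Qed.

Section packing.
Context {R : realType} {n : nat}.
Local Notation C := R[i].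
Implicit Types (z w : 'rV[C]_n.+1) (W : seq 'rV[C]_n.+1) (P : R).

(* Unit vectors satisfy this iff, after any change of phases, they remain at
   distance at least [1 / (5 sqrt P)]. *)
Definition projectively_separated P w w' := normc (ip w w') <= 1 - (50 * P)^-1.

(** After a change of phases, the rescaled real coordinates of the differences from [z] satisfy the
    hypothesis of [sum_separated_le], and the Gaussian is a product of one-variable Gaussians in
    them. *)
Lemma sum_separated_gauss P W z : 0 < P -> nsq z = 1 ->
  (forall w, w \in W -> nsq w = 1) -> pairwise (projectively_separated P) W ->
  \sum_(w <- W) expR (- (P * (1 - normc (ip z w)) / 4)) <= packing_constant R n.+1.
Proof.
move=> P0 z1 W1 Wsep.
pose m : R := n.+1%:R; have m1 : 1 <= m by rewrite /m ler1n.
pose w (i : 'I_(size W)) := W`_i.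
have w1 i : nsq (w i) = 1 by apply: W1; exact: mem_nth.
have sepC u v : projectively_separated P u v = projectively_separated P v u.
  by rewrite /projectively_separated -ip_conj normc_conj.
have wsep i i' : i != i' -> projectively_separated P (w i) (w i').
  have sep k l : (k < l)%N -> (k < size W)%N -> (l < size W)%N ->
    projectively_separated P W`_k W`_l.
    by move=> kl kW lW; exact: (pairwiseP 0 Wsep).
  rewrite -val_eqE neq_ltn => /orP[ii'|i'i]; last rewrite sepC; exact: sep.
(* With these phases the squared distance from [z] to [a i *: w i] is
   [2 * (1 - normc (ip z (w i)))]. *)
have [a a1 za] : exists2 a : 'I_(size W) -> C, forall i, normc (a i) = 1 &
    forall i, Re (ip z (a i *: w i)) = normc (ip z (w i)).
  have h i : exists b, normc b = 1 /\ Re (ip z (w i) * conjc b) = normc (ip z (w i)).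
    by have [b ? ?] := unimodular_align (ip z (w i)); exists b.
  have [a aP] := choice h; exists a => i; have [//] := aP i.
  by rewrite ipZr mulrC.
(* Vectors with any phases stay at squared distance at least [(25 * P)^-1]; scaling by [e] turns
   this into a gap of at least 1 in some real coordinate. *)
pose e := 10 * m * Num.sqrt P.
have e0 : 0 < e by rewrite !mulr_gt0 ?sqrtr_gt0//; lra.
have e2 : e ^+ 2 = 100 * m ^+ 2 * P.
  by rewrite /e !exprMn sqr_sqrtr ?ltW// -natrX.
pose d i := z - a i *: w i.
pose x i (j : 'I_n.+1 * bool) : R :=
  e * (if j.2 then Re (d i 0 j.1) else Im (d i 0 j.1)).
have sumx i : \sum_j x i j ^+ 2 = e ^+ 2 * (2 * (1 - normc (ip z (w i)))).
  rewrite -(pair_bigA _ (fun j b => x i (j, b) ^+ 2))/=.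
  transitivity (e ^+ 2 * nsq (d i)).
    rewrite /nsq mulr_sumr; apply: eq_bigr => j _.
    by rewrite big_bool /x/= !exprMn -mulrDr sqr_normc.
  rewrite nsqB nsqZ z1 w1 a1 za expr1n; congr (_ * _); ring.
have sepx i i' : i != i' -> exists j, 1 <= `|x i j - x i' j|.
  move=> ii'; apply: contrapT => /forallNP small.
  have : nsq (d i - d i') < (25 * P)^-1.
    have -> : (25 * P)^-1 = \sum_(j < n.+1) (25 * P * m)^-1.
      rewrite sumr_const card_ord -(mulr_natr _ n.+1) -/m.
      by field; apply/andP; split; apply/negP => /eqP; lra.
    apply: ltr_sum => [|j _]; first by apply/hasP; exists ord0; rewrite ?mem_index_enum.
    have /negP := small (j, true); have /negP := small (j, false).
    rewrite -!ltNge /x/= -!mulrBr => hI hR.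
    have -> : (25 * P * m)^-1 = 4 * m / e ^+ 2.
      by rewrite e2; field; apply/andP; split; apply/negP => /eqP; lra.
    rewrite ltr_pdivlMr ?exprn_gt0// sqr_normc.
    have hsq (y : R) : `|y| < 1 -> y ^+ 2 < 1.
      by move=> y1; rewrite -real_normK ?num_real// expr_lt1.
    move: hR hI => /hsq + /hsq; rewrite !exprMn.
    have -> : Re ((d i - d i') 0 j) = Re (d i 0 j) - Re (d i' 0 j).
      by rewrite !mxE; case: (z 0 j + _) (z 0 j + _) => ? ? [].
    have -> : Im ((d i - d i') 0 j) = Im (d i 0 j) - Im (d i' 0 j).
      by rewrite !mxE; case: (z 0 j + _) (z 0 j + _) => ? ? [].
    nra.
  have -> : d i - d i' = a i' *: w i' - a i *: w i.
    by rewrite /d opprB addrC addrA subrK.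
  rewrite nsqB !nsqZ !w1 !a1 expr1n ipZr ipZl.
  have := wsep _ _ ii'; rewrite sepC /projectively_separated.
  have := normr_Re_le (conjc (a i) * (a i' * ip (w i') (w i))).
  rewrite !ComplexField.Normc.normcM normc_conj !a1 !mul1r.
  move=> /(le_trans (ler_norm _)).
  have -> : (25 * P)^-1 = 2 * (50 * P)^-1 by field; apply/negP => /eqP; lra.
  lra.
have := sum_separated_le sepx.
rewrite card_prod card_ord card_bool => hgrid.
(* For this [k] the exponent is the sum of the [x i j ^+ 2 / k], and [1 + y <= k * expR (y / k)] for
   [y >= 0] because [k >= 1]. *)
have [k [k1 kE]] : exists k, 1 <= k /\ k = 800 * m ^+ 2.
  by exists (800 * m ^+ 2); split=> //; nra.
rewrite /packing_constant -/m -kE exprMn.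
apply: le_trans (ler_wpM2l _ hgrid); last by rewrite exprn_ge0//; lra.
have -> : k ^+ (n.+1 * 2) = \prod_(j : 'I_n.+1 * bool) k.
  by rewrite prodr_const card_prod card_ord card_bool.
rewrite (big_nth 0) big_mkord mulr_sumr.
apply: ler_sum => i _; rewrite -/(w i).
have -> : - (P * (1 - normc (ip z (w i))) / 4) = \sum_j - (x i j ^+ 2 / k).
  rewrite sumrN -mulr_suml sumx e2 kE; field; apply/negP => /eqP; lra.
rewrite expR_sum -big_split/=; apply: ler_prod => j _.
have k0 : 0 < k by lra.
rewrite expR_ge0/= expRN -ler_pdivrMl// -invfM.
rewrite lef_pV2 ?posrE ?mulr_gt0 ?expR_gt0 ?ltr_pwDl ?sqr_ge0//.
have := expR_ge1Dx (x i j ^+ 2 / k).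
rewrite -(ler_pM2l k0) => /(le_trans _); apply.
by rewrite mulrDr mulr1 mulrCA mulfV ?gt_eqF// mulr1; lra.
Qed.

End packing.

(** * Maximal nets and pointwise bounds for a single wave *)

Section net.
Context {R : realType} {n : nat}.
Local Notation C := R[i].

(** A separated family of largest size works: a unit vector that it fails to cover could be added to
    it. *)
Lemma exists_net (P : R) : 0 < P -> exists W : seq 'rV[C]_n.+1,
  [/\ forall w, w \in W -> nsq w = 1,
      pairwise (projectively_separated P) W &
      forall z, nsq z = 1 -> exists2 w, w \in W & 1 - (50 * P)^-1 < normc (ip z w)].
Proof.
move=> P0.
pose net (W : seq 'rV[C]_n.+1) := (forall w, w \in W -> nsq w = 1) /\
  pairwise (projectively_separated P) W.
pose Q k := `[< exists2 W, net W & size W = k >].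
pose M : R := packing_constant R n.+1 * expR (P / 4).
(* At one fixed unit vector every Gaussian term is at least [expR (- (P / 4))], so the packing bound
   limits the number of terms. *)
have bnd k : Q k -> (k <= Num.truncn M)%N.
  move=> /asboolP[W [W1 Wsep] <-].
  have d1 : nsq (delta_mx 0 ord0 : 'rV[C]_n.+1) = 1.
    by apply/norm2_eq1; exact: norm2_delta.
  rewrite truncn_ge_nat; last by rewrite mulr_ge0 ?expR_ge0 ?packing_constant_ge0.
  rewrite -ler_pdivrMr ?expR_gt0// -expRN.
  apply: le_trans (sum_separated_gauss P0 d1 W1 Wsep).
  have -> : (size W)%:R * expR (- (P / 4)) = \sum_(w <- W) expR (- (P / 4)).
    by rewrite big_const_seq count_predT iter_addr_0 mulr_natl.
  apply: ler_sum => w _; rewrite ler_expR lerN2 ler_pM2r// ler_piMr ?(ltW P0)//.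
  by rewrite gerBl normc_ge0.
have Q0 : exists k, Q k by exists 0%N; apply/asboolP; exists [::].
case: (ex_maxnP Q0 bnd) => k /asboolP[W [W1 Wsep] Wk] kmax.
exists W; split=> // z z1; apply: contrapT => far.
suff /kmax : Q k.+1 by rewrite ltnn.
apply/asboolP; exists (z :: W); last by rewrite /= Wk.
split=> [w|/=]; first by rewrite inE => /predU1P[->//|]; exact: W1.
rewrite Wsep andbT; apply/allP => w wW; rewrite /projectively_separated leNgt.
by apply/negP => zw; apply: far; exists w.
Qed.

(** This is Bernoulli's inequality; the induction step discards the nonnegative term
    [k%:R * x ^+ 2]. *)
Lemma onem_exp_ge (x : R) k : x <= 1 -> 1 - k%:R * x <= (1 - x) ^+ k.
Proof.
move=> x1; elim: k => [|k IH]; first by rewrite mul0r subr0 expr0.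
have : (1 - k%:R * x) * (1 - x) <= (1 - x) ^+ k * (1 - x).
  by rewrite ler_wpM2r// subr_ge0.
rewrite -exprSr; apply: le_trans; rewrite -natr1.
have : 0 <= k%:R * x ^+ 2 by rewrite mulr_ge0// sqr_ge0.
lra.
Qed.

Definition wave_upper (q : nat) : R := expR 3 * q.+1%:R ^+ q.

Definition wave_lower (q : nat) : R := 4 / 5 * (1 / 2) ^+ q.

(** Here [a] and [b] stand for the moduli of the components of [z] along [w] and [w'], and
    [4 / (5 * r)] is the tilt. The [p]-th power decays like [expR (- (p%:R * (1 - a) / 2))], and the
    [q]-th power costs at most half of this decay. *)
Lemma wave_upperP (p q : nat) (r a b : R) : (0 < p)%N -> 0 < r -> r ^+ 2 = p%:R ->
  0 <= a -> 0 <= b -> a ^+ 2 + b ^+ 2 <= 1 ->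
  r ^+ q * ((a + 4 / (5 * r) * b) ^+ p * (b + 4 / (5 * r) * a) ^+ q) <=
  wave_upper q * expR (- (p%:R * (1 - a) / 4)).
Proof.
move=> p0 r0 r2 a0 b0 ab1; set s := 4 / (5 * r).
have s0 : 0 < s by rewrite divr_gt0 ?mulr_gt0.
have rs : r * s = 4 / 5 by rewrite /s; field; apply/negP => /eqP; lra.
clearbody s; have a1 : a <= 1 by nra.
have [r0' s0'] := (ltW r0, ltW s0).
(* This is the distance from [z] to [w] after aligning phases; [b <= t] because
   [1 - a ^+ 2 <= 2 - 2 * a]. *)
pose t := Num.sqrt (2 - 2 * a).
have t0 : 0 <= t by exact: sqrtr_ge0.
have t2 : t ^+ 2 = 2 - 2 * a by rewrite sqr_sqrtr//; lra.
have bt : b <= t by rewrite -(@ler_pXn2r _ 2)// t2; nra.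
have E1 : (a + s * b) ^+ p <= expR (1 - p%:R * (1 - a) / 2).
  apply: (@le_trans _ _ (expR (s ^+ 2 - t ^+ 2 / 4) ^+ p)).
    apply: lerXn2r; rewrite ?nnegrE ?expR_ge0 ?addr_ge0 ?mulr_ge0//.
    apply: le_trans (expR_ge1Dx _).
    have : s * b <= s * t by rewrite ler_wpM2l.
    by have := sqr_ge0 (s - t / 2); lra.
  rewrite -expRM_natl ler_expR t2 mulrBr -r2 -exprMn rs.
  lra.
have E2 : (r * (b + s * a)) ^+ q <= q.+1%:R ^+ q * expR (p%:R * (1 - a) / 4 + 2).
  have Q0 : 0 < q.+1%:R :> R by [].
  (* Dividing by [q.+1] rather than [q] also covers [q = 0]. *)
  have : r * (b + s * a) <= q.+1%:R * expR ((r * t) / q.+1%:R).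
    apply: (@le_trans _ _ (r * t + 1)).
      have : r * b <= r * t by rewrite ler_wpM2l.
      by rewrite mulrDr mulrA rs; nra.
    apply: (@le_trans _ _ (q.+1%:R * (1 + (r * t) / q.+1%:R))).
      rewrite mulrDr mulr1 mulrCA mulfV ?gt_eqF// mulr1 addrC lerD2r.
      by rewrite ler1n.
    by rewrite ler_pM2l// expR_ge1Dx.
  move=> h; apply: le_trans (lerXn2r q _ _ h) _.
  - by rewrite nnegrE mulr_ge0 ?addr_ge0 ?mulr_ge0.
  - by rewrite nnegrE mulr_ge0 ?expR_ge0.
  rewrite exprMn ler_pM2l ?exprn_gt0// -expRM_natl ler_expR.
  apply: (@le_trans _ _ (r * t)).
    rewrite mulrCA ler_piMr ?mulr_ge0// ler_pdivrMr// mul1r.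
    by rewrite ler_nat.
  have := sqr_ge0 (r * t / 4 - 1); rewrite -r2.
  have -> : 1 - a = t ^+ 2 / 2 by rewrite t2; lra.
  lra.
rewrite mulrCA -exprMn.
apply: le_trans (ler_pM _ _ E1 E2) _.
- by rewrite exprn_ge0// addr_ge0// mulr_ge0.
- by rewrite exprn_ge0// mulr_ge0 ?addr_ge0 ?mulr_ge0.
rewrite [leLHS]mulrCA -expRD /wave_upper [expR 3 * _]mulrC -[leRHS]mulrA -expRD.
rewrite ler_pM2l ?exprn_gt0// ler_expR; lra.
Qed.

(** Within the covering radius [r * b] is at most 1/5. Hence [A] is at least [1 - 1 / (5 p)], whose
    [p]-th power is at least 4/5 by Bernoulli, and [r * B] is at least 1/2. *)
Lemma wave_lowerP (p q : nat) (r a b A B : R) : (0 < p)%N -> 0 < r -> r ^+ 2 = p%:R ->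
  1 - (50 * p%:R)^-1 < a -> a <= 1 -> 0 <= b -> a ^+ 2 + b ^+ 2 <= 1 ->
  a - 4 / (5 * r) * b <= A -> 4 / (5 * r) * a - b <= B ->
  wave_lower q <= r ^+ q * (A ^+ p * B ^+ q).
Proof.
move=> p0 r0 r2 aP a1 b0 ab1; set s := 4 / (5 * r) => hA hB.
have p1 : 1 <= p%:R :> R by rewrite ler1n.
have ip0 : 0 < (p%:R)^-1 :> R by rewrite invr_gt0; lra.
have ip1 : (p%:R)^-1 <= 1 :> R by rewrite invf_le1; lra.
have s0 : 0 < s by rewrite divr_gt0 ?mulr_gt0.
have rs : r * s = 4 / 5 by rewrite /s; field; apply/negP => /eqP; lra.
have {}aP : 1 - (p%:R)^-1 / 50 < a by rewrite invfM mulrC in aP.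
have rb : r * b <= 1 / 5.
  rewrite -(@ler_pXn2r _ 2)// ?nnegrE ?mulr_ge0//; [rewrite exprMn r2|lra..].
  rewrite mulrC -ler_pdivlMr; last by lra.
  have : b ^+ 2 <= 2 * (1 - a) by nra.
  by rewrite expr_div_n expr1n; lra.
have sb : s * b <= 4 / 25 * (p%:R)^-1.
  rewrite -r2 ler_pdivlMr ?exprn_gt0// expr2.
  have -> : s * b * (r * r) = (r * s) * (r * b) by ring.
  by rewrite rs; lra.
have E1 : 4 / 5 <= A ^+ p.
  apply: (@le_trans _ _ ((1 - (p%:R)^-1 / 5) ^+ p)).
    apply: le_trans (onem_exp_ge p _); last by lra.
    by rewrite mulrA mulfV; lra.
  apply: lerXn2r; rewrite ?nnegrE; lra.
have E2 : (1 / 2) ^+ q <= (r * B) ^+ q.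
  have h : 1 / 2 <= r * B.
    have : r * (s * a - b) <= r * B by rewrite ler_pM2l.
    by rewrite mulrBr mulrA rs; lra.
  apply: lerXn2r; rewrite ?nnegrE; lra.
rewrite mulrCA -exprMn; apply: ler_pM E1 E2; first by lra.
by rewrite exprn_ge0//; lra.
Qed.

End net.

(** * Families of waves attached to a net *)

Section wave_family.
Context {R : realType} {n : nat}.
Local Notation C := R[i].

(* Tilting [w] to [u] by [s] keeps [v] from vanishing at the centre [w]: both
   factors are then of full size within the covering radius of the net. *)
Lemma exists_wave_family (p q : nat) : (0 < p)%N ->
  exists S : seq ('rV[C]_n.+2 * 'rV[C]_n.+2),
  [/\ forall uv, uv \in S -> ip uv.2 uv.1 = 0,
      forall z, nsq z = 1 -> \sum_(uv <- S) normc (wave p q uv.1 uv.2 z) <=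
        wave_upper q * packing_constant R n.+2 &
      forall z, nsq z = 1 -> wave_lower q ^+ 2 <=
        \sum_(uv <- S) normc (wave p q uv.1 uv.2 z) ^+ 2].
Proof.
move=> p0; have P0 : 0 < p%:R :> R by rewrite ltr0n.
have [W [W1 Wsep Wcov]] := @exists_net R n.+1 _ P0.
pose r : R := Num.sqrt p%:R; have r0 : 0 < r by rewrite sqrtr_gt0.
have r2 : r ^+ 2 = p%:R by rewrite sqr_sqrtr// ltW.
pose s := 4 / (5 * r); have s0 : 0 <= s by rewrite divr_ge0 ?mulr_ge0 ?ltW.
have ex_orth (w : 'rV[C]_n.+2) : exists w', nsq w' = 1 /\ ip w w' = 0.
  by have [w' ? ?] := exists_orthonormal w; exists w'.
have [orth oP] := choice ex_orth.
pose f w := (w + s%:C%C *: orth w, orth w - s%:C%C *: w).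
(* [a] and [b] are the moduli of the components of [z] along [w] and [orth w], [A] and [B] those of
   the two factors of the wave; the triangle inequality compares them. *)
have fwave w z : nsq w = 1 -> nsq z = 1 ->
    exists a b A B, [/\ a = normc (ip z w), 0 <= b, a ^+ 2 + b ^+ 2 <= 1,
      normc (wave p q (f w).1 (f w).2 z) = r ^+ q * (A ^+ p * B ^+ q) &
      [/\ 0 <= A, 0 <= B, a - s * b <= A <= a + s * b &
        s * a - b <= B <= b + s * a]].
  move=> w1 z1; exists (normc (ip z w)), (normc (ip z (orth w))).
  exists (normc (ip z (f w).1)), (normc (ip (f w).2 z)); split=> //.
  - exact: normc_ge0.
  - by have [? ?] := oP w; exact: bessel2.
  - rewrite /wave /plane_wave !ComplexField.Normc.normcM !normcX normc_real// exprn_ge0.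
  rewrite -(ip_conj z (f w).2) normc_conj /= !ipDr ipNr !ipZr.
  have tri (x y : C) : normc x - normc y <= normc (x + y) <= normc x + normc y.
    rewrite le_normcD andbT lerBlDr -{1}(addrK y x).
    by apply: le_trans (le_normcD _ _) _; rewrite normcN.
  have ns (x : C) : normc (conjc s%:C%C * x) = s * normc x.
    by rewrite ComplexField.Normc.normcM normc_conj normc_real.
  split; [exact: normc_ge0|exact: normc_ge0|by rewrite -!ns tri|].
  rewrite [normc (ip z (orth w)) + _]addrC [_ - conjc _ * _]addrC -ns -normcN.
  exact: tri.
have sum_f (F : _ -> R) : \sum_(uv <- [seq f w | w <- W]) F uv =
    \sum_(w <- W) F (f w) by rewrite big_map.
exists [seq f w | w <- W]; split=> [_ /mapP[w wW ->]|z z1|z z1].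
- have [n1 wo] := oP w.
  rewrite /f/= -scaleN1r ipDr !ipZr !ipDl !ipZl !ipxx W1// n1 wo.
  by rewrite -(ip_conj w (orth w)) wo conjc0 conjc_real rmorph1 !mulr0 addr0 add0r
    !mulr1 mulN1r addNr.
- rewrite sum_f.
  apply: le_trans (ler_wpM2l _ (sum_separated_gauss P0 z1 W1 Wsep)); last first.
    by rewrite mulr_ge0 ?expR_ge0 ?exprn_ge0.
  rewrite mulr_sumr big_seq [leRHS]big_seq; apply: ler_sum => w /W1 w1.
  have [a [b [A [B [-> b0 ab1 -> [A0 B0 /andP[_ hA] /andP[_ hB]]]]]]] := fwave w z w1 z1.
  apply: le_trans (wave_upperP q p0 r0 r2 _ b0 ab1); last exact: normc_ge0.
  rewrite ler_wpM2l ?exprn_ge0 ?(ltW r0)// ler_pM ?exprn_ge0 ?lerXn2r ?nnegrE//.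
  - exact: le_trans hA.
  - exact: le_trans hB.
- rewrite sum_f; have [w wW zw] := Wcov z z1; have w1 := W1 w wW.
  have [a [b [A [B [aE b0 ab1 fE [A0 B0 /andP[hA _] /andP[hB _]]]]]]] := fwave w z w1 z1.
  rewrite -aE in zw.
  have a1 : a <= 1 by rewrite aE normc_ip_le1.
  (* The single net vector [w] covering [z] already accounts for the lower bound. *)
  rewrite (big_rem w)//= fE; apply: ler_wpDr.
    by apply: sumr_ge0 => ? _; exact: sqr_ge0.
  apply: lerXn2r; rewrite ?nnegrE ?mulr_ge0 ?exprn_ge0 ?(ltW r0)//.
  exact: wave_lowerP hA hB.
Qed.

(** The upper bound does not depend on [p], so dividing by it leaves a lower bound [c] that is
    uniform in [p]. *)
Lemma exists_normalized_wave_family (q : nat) :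
  exists2 c : R, 0 < c & forall p, (0 < p)%N ->
  exists (k : C) (S : seq ('rV[C]_n.+2 * 'rV[C]_n.+2)),
  [/\ forall uv, uv \in S -> ip uv.2 uv.1 = 0,
      forall z, nsq z = 1 ->
        \sum_(uv <- S) normc (plane_wave k p q uv.1 uv.2 z) <= 1 &
      forall z, nsq z = 1 ->
        c <= \sum_(uv <- S) normc (plane_wave k p q uv.1 uv.2 z) ^+ 2].
Proof.
pose M : R := wave_upper q * packing_constant R n.+2 + 1.
have M0 : 0 < M.
  rewrite ltr_wpDl// mulr_ge0 ?packing_constant_ge0//.
  by rewrite mulr_ge0 ?expR_ge0 ?exprn_ge0.
exists (wave_lower q ^+ 2 / M ^+ 2).
  by rewrite divr_gt0 ?exprn_gt0// mulr_gt0 ?exprn_gt0// divr_gt0.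
move=> p p0; have [S [So Sup Slow]] := exists_wave_family q p0.
exists (M^-1 * Num.sqrt p%:R ^+ q)%:C%C, S.
have scale (uv : 'rV[C]_n.+2 * 'rV[C]_n.+2) z :
    normc (plane_wave (M^-1 * Num.sqrt p%:R ^+ q)%:C%C p q uv.1 uv.2 z) =
    M^-1 * normc (wave p q uv.1 uv.2 z).
  rewrite /wave /plane_wave rmorphM -mulrA ComplexField.Normc.normcM normc_real//.
  by rewrite invr_ge0 ltW.
split=> // z z1.
  under eq_bigr do rewrite scale.
  by rewrite -mulr_sumr ler_pdivrMl// mulr1 (le_trans (Sup z z1))// lerDl.
under eq_bigr do rewrite scale exprMn.
by rewrite -mulr_sumr mulrC exprVn ler_pM2l ?invr_gt0 ?exprn_gt0// Slow.
Qed.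

End wave_family.

(** * Harmonicity and bihomogeneity of plane waves *)

(* The product rule for [A^p * B^q] along a direction and along [i] times it,
   where [A] is complex linear and [B] is antilinear. *)
Lemma wirtinger_zbar (K : comNzRingType) (h i c A A' a B B' b : K) p q :
  i * i = -1 -> h + h = 1 ->
  h * (c * ((A' * a) *+ p * B + A * (B' * b) *+ q) +
       i * (c * ((A' * (i * a)) *+ p * B + A * (B' * (- i * b)) *+ q))) =
  c * (A * (B' * b) *+ q).
Proof.
move=> ii hh; rewrite -!(mulr_natr (_ * _)).
transitivity ((h * (1 + i * i)) * (c * (A' * a * p%:R * B)) +
   (h * (1 - i * i)) * (c * (A * (B' * b) * q%:R))); first ring.
by rewrite ii subrr mulr0 mul0r add0r opprK mulrDr mulr1 hh mul1r; ring.
Qed.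

Lemma wirtinger_z (K : comNzRingType) (h i c A A' a B B' b : K) p q :
  i * i = -1 -> h + h = 1 ->
  h * (c * ((A' * a) *+ p * B + A * (B' * b) *+ q) -
       i * (c * ((A' * (i * a)) *+ p * B + A * (B' * (- i * b)) *+ q))) =
  c * ((A' * a) *+ p * B).
Proof.
move=> ii hh; rewrite -!(mulr_natr (_ * _)).
transitivity ((h * (1 - i * i)) * (c * (A' * a * p%:R * B)) +
   (h * (1 + i * i)) * (c * (A * (B' * b) * q%:R))); first ring.
by rewrite ii subrr mulr0 mul0r addr0 opprK mulrDr mulr1 hh mul1r.
Qed.

Section harmonic_waves.
Context {R : realType} {n : nat}.
Local Notation C := R[i].
Implicit Types (f : 'rV[C]_n -> C) (u v z : 'rV[C]_n).

Let RePoly (P : {poly C}) : {poly R} := \poly_(i < size P) Re P`_i.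
Let ImPoly (P : {poly C}) : {poly R} := \poly_(i < size P) Im P`_i.

Let Re_horner (P : {poly C}) (t : R) : Re P.[t%:C%C] = (RePoly P).[t].
Proof.
rewrite horner_coef Re_sum (horner_coef_wide _ (size_poly _ _)).
apply: eq_bigr => i _; rewrite coef_poly ltn_ord -rmorphXn.
by case: (P`_i) => x y /=; rewrite mulr0 subr0.
Qed.

Let Im_horner (P : {poly C}) (t : R) : Im P.[t%:C%C] = (ImPoly P).[t].
Proof.
rewrite horner_coef (big_morph _ (@ImD R) (erefl : Im 0 = 0)).
rewrite (horner_coef_wide _ (size_poly _ _)).
apply: eq_bigr => i _; rewrite coef_poly ltn_ord -rmorphXn.
by case: (P`_i) => x y /=; rewrite mulr0 add0r.
Qed.

Let derive1_horner0 (P : {poly R}) : derive1 (fun t : R => P.[t]) 0 = P`_1.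
Proof.
rewrite derive1E (@derive_val _ _ _ _ _ _ _ (is_derive_poly P 0)).
by rewrite horner_coef0 coef_deriv mulr1n.
Qed.

(** At real arguments the real and imaginary parts of [P] are real polynomials, so the derivative at
    0 is the linear coefficient. *)
Lemma real_derive_poly f v z (P : {poly C}) :
  (forall t : R, f (z + t%:C%C *: v) = P.[t%:C%C]) -> real_derive f v z = P`_1.
Proof.
move=> fP; rewrite /real_derive.
under [fun t : R => Re _]eq_fun do rewrite fP Re_horner.
under [fun t : R => Im _]eq_fun do rewrite fP Im_horner.
rewrite !derive1_horner0 !coef_poly.
case: ltnP => [_|P1]; first by case: (P`_1).
by rewrite nth_default.
Qed.

Lemma real_derive_plane_wave c p q u v e z :
  real_derive (plane_wave c p q u v) e z =
  c * ((ip z u ^+ p.-1 * ip e u) *+ p * ip v z ^+ q +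
       ip z u ^+ p * (ip v z ^+ q.-1 * ip v e) *+ q).
Proof.
(* On a real line [t] equals its conjugate, so both factors of the wave are powers of affine
   polynomials in [t]. *)
pose L a b : {poly C} := a%:P + b *: 'X.
rewrite (@real_derive_poly _ _ _
  (c *: (L (ip z u) (ip e u) ^+ p * L (ip v z) (ip v e) ^+ q))); last first.
  move=> t; rewrite /plane_wave hornerZ hornerM !horner_exp /L !hornerE.
  by rewrite ipDl ipDr ipZl ipZr conjc_real ![t%:C%C * _]mulrC.
rewrite -[LHS]mulr1n -coef_deriv -horner_coef0 derivZ derivM !deriv_exp.
rewrite /L !derivD !derivC !derivZ !derivX !add0r !alg_polyC.
rewrite !(hornerZ, hornerD, hornerM, hornerMn, horner_exp, hornerC, hornerX).
by rewrite !mulr0 !addr0 !mulrnAr !mulrnAl [ip e u * _]mulrC [ip v e * _]mulrC.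
Qed.

(** [partial_zbar] brings out the coordinate [v 0 j] and [partial_z] the conjugate of [u 0 j];
    summed over [j] these form the factor [ip v u]. *)
Lemma laplacian_plane_wave c p q u v z : ip v u = 0 ->
  laplacian (plane_wave c p q u v) z = 0.
Proof.
move=> vu.
have ipd j (x : 'rV[C]_n) : ip (delta_mx 0 j) x = conjc (x 0 j).
  rewrite /ip (bigD1 j)//= mxE !eqxx mul1r big1 ?addr0// => k /negPf kj.
  by rewrite mxE kj andbF mul0r.
have ii : 'i%C * 'i%C = -1 :> C by rewrite -expr2 sqr_i.
have conj_i : conjc 'i%C = - 'i%C :> C by apply/eqP; rewrite eq_complex/= oppr0 !eqxx.
have h2 : 2^-1 + 2^-1 = 1 :> C by rewrite [RHS](splitr (1 : C)) mul1r.
have dzbar j : partial_zbar j (plane_wave c p q u v) =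
    plane_wave (c * v 0 j *+ q) p q.-1 u v.
  apply/funext => x; rewrite /partial_zbar !real_derive_plane_wave /plane_wave.
  rewrite !ipZl !ipZr conj_i -!(ip_conj (delta_mx 0 j) v) !ipd conjcK.
  by rewrite wirtinger_zbar// -!(mulr_natr (_ * _)); ring.
have dz j d r s x : partial_z j (plane_wave d r s u v) x =
    d * ((ip x u ^+ r.-1 * conjc (u 0 j)) *+ r * ip v x ^+ s).
  rewrite /partial_z !real_derive_plane_wave.
  rewrite !ipZl !ipZr conj_i -!(ip_conj (delta_mx 0 j) v) !ipd conjcK.
  by rewrite wirtinger_z.
rewrite /laplacian.
under eq_bigr do rewrite dzbar dz.
transitivity (\sum_j (v 0 j * conjc (u 0 j)) *
    (c * q%:R * ip z u ^+ p.-1 * p%:R * ip v z ^+ q.-1)).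
  apply: eq_bigr => j _; rewrite -!(mulr_natr (_ * _)); ring.
by rewrite -mulr_suml -/(ip v u) vu mul0r.
Qed.

(** Expanding a [k]-th power of a sum chooses a coordinate in each factor; this multi-index counts
    how often the choice [h] takes each coordinate. *)
Let count_mi k (h : {ffun 'I_k -> 'I_n}) : {ffun 'I_n -> 'I_k.+1} :=
  [ffun j => inord #|[pred i | h i == j]|].

Let count_miE k (h : {ffun 'I_k -> 'I_n}) j :
  count_mi h j = #|[pred i | h i == j]| :> nat.
Proof.
rewrite ffunE inordK// ltnS.
by apply: leq_trans (max_card _) _; rewrite card_ord.
Qed.

Let count_miP k (h : {ffun 'I_k -> 'I_n}) :
  (\sum_j (count_mi h j : nat) == k)%N.
Proof.
apply/eqP; rewrite -[RHS](card_ord k) -sum1_card (partition_big h predT)//=.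
by apply: eq_bigr => j _; rewrite count_miE -sum1_card; apply: eq_bigl.
Qed.

Let mi k (h : {ffun 'I_k -> 'I_n}) : multi_index n k :=
  exist _ (count_mi h) (count_miP h).

(** This is the multinomial expansion, with each coefficient kept as a sum over the choices of the
    given multi-index. *)
Lemma exp_sum_multi_index k (x c : 'I_n -> C) :
  (\sum_j x j * c j) ^+ k = \sum_(a : multi_index n k)
    (\sum_(h : {ffun 'I_k -> 'I_n} | mi h == a) \prod_i c (h i)) *
    \prod_j x j ^+ val a j.
Proof.
rewrite -{1}(card_ord k) -prodr_const bigA_distr_bigA/=.
rewrite (partition_big (@mi k) predT)//=; apply: eq_bigr => a _.
rewrite mulr_suml; apply: eq_bigr => h /eqP <-.
rewrite big_split/= mulrC; congr (_ * _).
rewrite (partition_big h predT)//=; apply: eq_bigr => j _.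
rewrite count_miE -prodr_const; apply: congr_big => // i /eqP -> //.
Qed.

Lemma bihomogeneous_plane_wave c p q u v :
  bihomogeneous p q (plane_wave c p q u v).
Proof.
pose cf k (w : 'I_n -> C) (a : multi_index n k) : C :=
  \sum_(h : {ffun 'I_k -> 'I_n} | mi h == a) \prod_i w (h i).
exists (fun a b => c * (cf p (fun j => conjc (u 0 j)) a * cf q (fun j => v 0 j) b)).
move=> z; rewrite /plane_wave /ip.
under [X in _ * (_ * X ^+ q)]eq_bigr do rewrite mulrC.
rewrite !exp_sum_multi_index mulr_suml mulr_sumr; apply: eq_bigr => a _.
rewrite mulr_sumr mulr_sumr; apply: eq_bigr => b _.
rewrite -!mulrA; congr (_ * _); rewrite -/(cf _ _ _) -/(cf _ _ _).
by congr (_ * _); rewrite /bimonomial big_split/= mulrCA.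
Qed.

Lemma harmonic_plane_wave c p q u v : ip v u = 0 ->
  Defs.harmonic p q (plane_wave c p q u v).
Proof.
by move=> vu; split=> [|z]; [exact: bihomogeneous_plane_wave|exact: laplacian_plane_wave].
Qed.

End harmonic_waves.

(** * Separated families in metric spaces *)

(** Finitely many balls of radius [c / 2] would cover the closure, and each contains [x p] for at
    most one [p] in [J], which would make [J] finite. *)
Lemma separated_not_precompact (R : realType) (T : metricType R) (A : set T)
    (J : set nat) (x : nat -> T) (c : R) :
  0 < c -> infinite_set J -> (forall p, J p -> A (x p)) ->
  (forall p p', J p -> J p' -> (p' < p)%N -> c <= mdist (x p) (x p')) ->
  ~ precompact A.
Proof.
move=> c0 Jinf xA sep; rewrite precompactE => cptA.
(* Compactness by covers is used over a pointed space, with [x 0] as the point. *)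
pose P : ptopologicalType := HB.pack T (isPointed.Build T (x 0%N)).
have cov : @cover_compact P (closure A) by rewrite -(@compact_cover P).
pose f (y : T) := (ball y (c / 2))^°.
have c20 : 0 < c / 2 by rewrite divr_gt0.
have [||D _ AD] := cov T setT f.
- by move=> y _; exact: open_interior.
- by move=> y _; exists y => //; exact: nbhsx_ballx.
apply: Jinf.
have JD : J `<=` \bigcup_(y in [set` D]) [set p | J p /\ ball y (c / 2) (x p)].
  move=> p Jp; have [y Dy fy] := AD _ (subset_closure (xA _ Jp)).
  by exists y => //; split=> //; exact: interior_subset fy.
apply: (sub_finite_set JD); apply: bigcup_finite => // y _.
have [[p0 [Jp0 yp0]]|none] := pselect (exists p, J p /\ ball y (c / 2) (x p)); last first.
  by rewrite (_ : [set _ | _] = set0)// -subset0 => p yp; apply: none; exists p.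
apply: (@sub_finite_set _ _ [set p0]) => // p [Jp yp].
move: yp yp0; rewrite ballEmdist /= => yp yp0.
have lt2 : mdist (x p) (x p0) < c.
  apply: le_lt_trans (metric_triangle _ y _) _.
  by rewrite (metric_sym (x p)) (splitr c) ltrD.
have [pp0|p0p|//] := ltngtP p p0.
  by have := sep _ _ Jp0 Jp pp0; rewrite metric_sym leNgt lt2.
by have := sep _ _ Jp Jp0 p0p; rewrite leNgt lt2.
Qed.

(** * Waves as continuous functions on the sphere, and the circle action *)

Section sphere_waves.
Context {R : realType} {n : nat}.
Local Notation C := R[i].
Local Notation S := (sphere R n).
Implicit Types (u v : 'rV[C]_n).

Lemma nsq_sphere (z : S) : nsq (sphere_val z) = 1.
Proof. exact/norm2_eq1/sphere_valP. Qed.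

Lemma continuous_conjc : continuous (@conjc R : C -> C).
Proof.
move=> z; apply/(@cvgrPdist_lt _ _ _ (nbhs z)) => e e0.
near=> w; rewrite -rmorphB normcJ; near: w; exact: cvgr_dist_lt.
Unshelve. all: by end_near. Qed.

Let continuous_mulc (f g : S -> C) :
  continuous f -> continuous g -> continuous (fun z => f z * g z).
Proof. by move=> cf cg z; apply: (@cvgM _ _ (nbhs z)); [exact: cf|exact: cg]. Qed.

Let continuous_expc (f : S -> C) k :
  continuous f -> continuous (fun z => f z ^+ k).
Proof.
move=> cf; elim: k => [|k IH].
  by under eq_fun do rewrite expr0; move=> z; exact: cst_continuous.
by under eq_fun do rewrite exprS; exact: continuous_mulc.
Qed.

Let continuous_ipl u : continuous (fun z : S => ip (sphere_val z) u).
Proof.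
have -> : (fun z : S => ip (sphere_val z) u) =
    \sum_j (fun z : S => sphere_val z 0 j * conjc (u 0 j)).
  by rewrite fct_sumE.
elim/big_ind : _ => [|f g cf cg z|j _].
- exact: cst_continuous.
- by apply: (@cvgD _ _ _ (nbhs z)); [exact: cf|exact: cg].
apply: continuous_mulc => z; last exact: cst_continuous.
apply: (@continuous_comp _ _ _ sphere_val (fun x : 'rV[C]_n => x 0 j)).
  exact: continuous_sphere_val.
exact: continuous_coord.
Qed.

Lemma continuous_plane_wave (c : C) p q u v :
  continuous (fun z : S => plane_wave c p q u v (sphere_val z)).
Proof.
apply: continuous_mulc; first by move=> z; exact: cst_continuous.
apply: continuous_mulc; apply: continuous_expc; first exact: continuous_ipl.
under eq_fun do rewrite -ip_conj.
move=> z; apply: (@continuous_comp _ _ _ (fun z : S => ip (sphere_val z) v) (@conjc R)).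
  exact: continuous_ipl.
exact: continuous_conjc.
Qed.

Definition sphere_wave (c : C) p q u v : csphere R n :=
  to_csphere (@continuous_plane_wave c p q u v).

Lemma sphere_waveE c p q u v z :
  sphere_wave c p q u v z = plane_wave c p q u v (sphere_val z).
Proof. by []. Qed.

Lemma norm2_rotate (a : C) (z : S) : normc a = 1 -> norm2 (a *: sphere_val z) = 1.
Proof.
move=> a1; apply/norm2_eq1.
by rewrite -/(nsq _) nsqZ a1 expr1n mul1r nsq_sphere.
Qed.

Definition rotate (a : C) (a1 : normc a = 1) (z : S) : S :=
  to_sphere (norm2_rotate z a1).

(** This transformation law under the circle is all that the separation in L1 uses of the
    bidegree. *)
Definition sphere_homogeneous p q (f : csphere R n) := forall a (a1 : normc a = 1) z,
  f (rotate a1 z) = a ^+ p * conjc a ^+ q * f z.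

Lemma sphere_homogeneous_wave c p q u v :
  sphere_homogeneous p q (sphere_wave c p q u v).
Proof.
move=> a a1 z; rewrite !sphere_waveE to_sphereK /plane_wave ipZl ipZr !exprMn.
ring.
Qed.

Lemma sphere_homogeneousD p q (f g : csphere R n) (b : C) :
  sphere_homogeneous p q f -> sphere_homogeneous p q g ->
  sphere_homogeneous p q (f + b *: g).
Proof.
move=> hf hg a a1 z.
transitivity (f (rotate a1 z) + b * g (rotate a1 z)); first by [].
transitivity (a ^+ p * conjc a ^+ q * (f z + b * g z)); last by [].
by rewrite hf hg; ring.
Qed.

Lemma continuous_rotate (a : C) (a1 : normc a = 1) : continuous (rotate a1).
Proof.
apply: (@continuous_comp_initial _ _ _ (@sphere_val R n)).
move=> z; apply: (@continuous_comp S 'rV[C]_n _ sphere_val (fun x => a *: x)).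
  exact: continuous_sphere_val.
exact: scaler_continuous.
Qed.

End sphere_waves.

(** * Finite linear combinations *)

Section linear_span.
Context (K : numFieldType) (V : lmodType K) (A : set V).

Lemma linear_span0 : linear_span A 0.
Proof.
exists 0%N, (fun=> 0), (fun=> 0); split=> [[]//|].
by rewrite big_ord0.
Qed.

Lemma linear_spanD (x y : V) (a : K) : linear_span A x -> A y ->
  linear_span A (x + a *: y).
Proof.
move=> [m [c [v [Av ->]]]] Ay.
(* Index 0 carries the new vector; the old indices are shifted by one. *)
exists m.+1, (fun i => oapp c a (unlift ord0 i)), (fun i => oapp v y (unlift ord0 i)).
split=> [i|]; first by case: (unlift ord0 i) => [j|]/=.
rewrite big_ord_recl unlift_none /= addrC; congr (_ + _).
by apply: eq_bigr => i _; rewrite liftK.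
Qed.

Lemma sub_linear_span (B : set V) : A `<=` B -> linear_span A `<=` linear_span B.
Proof. by move=> AB x [m [c [v [Av ->]]]]; exists m, c, v; split=> // i; apply/AB/Av. Qed.

End linear_span.

(** * Choice of signs in L2 and separation in L1 by rotation *)

Section integrals.
Context {R : realType} {n : nat} (sigma : probability (borel_sphere R n.+1) R).
Local Notation C := R[i].
Local Notation S := (borel_sphere R n.+1).
Implicit Types f g : csphere R n.+1.

Definition L1norm f : \bar R := (\int[sigma]_(z in [set: S]) (normc (f z))%:E)%E.
Definition L2norm2 f : \bar R := (\int[sigma]_(z in [set: S]) (normc (f z) ^+ 2)%:E)%E.

Lemma measurable_normc_csphere f :
  measurable_fun [set: S] ((fun z => normc (f z)) : S -> R).
Proof.
apply: (@continuous_borel_measurable R n) => z; apply: continuous_comp.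
  exact: csphereP.
exact: continuous_normc.
Qed.

Lemma measurable_sqr_normc_csphere f :
  measurable_fun [set: S] ((fun z => normc (f z) ^+ 2) : S -> R).
Proof. by apply: measurable_funX; exact: measurable_normc_csphere. Qed.

Let integral_add (h1 h2 : S -> R) :
  measurable_fun setT h1 -> measurable_fun setT h2 ->
  (forall z, 0 <= h1 z) -> (forall z, 0 <= h2 z) ->
  (\int[sigma]_z (h1 z)%:E + \int[sigma]_z (h2 z)%:E =
   \int[sigma]_z (h1 z + h2 z)%:E)%E.
Proof.
move=> m1 m2 p1 p2; rewrite -ge0_integralD//.
- by move=> z _; rewrite lee_fin.
- exact/measurable_EFinP.
- by move=> z _; rewrite lee_fin.
- exact/measurable_EFinP.
Qed.

Lemma L2norm2_parallelogram f g :
  (L2norm2 (f + g)%R + L2norm2 (f - g)%R =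
   (L2norm2 f + L2norm2 g) + (L2norm2 f + L2norm2 g))%E.
Proof.
have m := measurable_sqr_normc_csphere.
have p (h : csphere R n.+1) z := sqr_ge0 (normc (h z)).
rewrite /L2norm2 !integral_add//; last 4 first.
- exact: measurable_funD.
- exact: measurable_funD.
- by move=> z; rewrite addr_ge0.
- by move=> z; rewrite addr_ge0.
apply: eq_integral => z _; congr EFin.
have := sqr_normcD (f z) (g z); have := sqr_normcB (f z) (g z).
rewrite -[f z - g z]/((f - g) z) -[f z + g z]/((f + g) z); lra.
Qed.

(** Signs are chosen one at a time: by the parallelogram law one of [f + g] and [f - g] has squared
    L2 norm at least the sum of the two. The pointwise bound holds for any signs, and [P] carries
    further properties along. *)
Lemma exists_signs (P : csphere R n.+1 -> Prop) (s : seq (csphere R n.+1)) :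
  P 0 -> (forall f g, P f -> g \in s -> P (f + g) /\ P (f - g)) ->
  exists f, [/\ P f, forall z, normc (f z) <= \sum_(g <- s) normc (g z) &
    (\sum_(g <- s) L2norm2 g <= L2norm2 f)%E].
Proof.
move=> P0; elim: s => [|g s IH] Ps.
  exists 0; split=> // [z|]; first by rewrite big_nil ComplexField.Normc.normc0.
  by rewrite big_nil; apply: integral_ge0 => z _; rewrite lee_fin sqr_ge0.
have [|f [Pf fs sf]] := IH.
  by move=> f h Pf hs; apply: Ps => //; rewrite inE hs orbT.
have [Pp Pm] := Ps f g Pf (mem_head _ _).
have par := L2norm2_parallelogram f g.
have [le|] := boolP (L2norm2 f + L2norm2 g <= L2norm2 (f + g)%R)%E.
  exists (f + g); split=> // [z|].
    rewrite big_cons [leRHS]addrC; apply: le_trans (le_normcD (f z) (g z)) _.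
    exact: lerD.
  by rewrite big_cons addeC (le_trans _ le)// leeD.
rewrite -ltNge => lt1.
exists (f - g); split=> // [z|].
  rewrite big_cons [leRHS]addrC; apply: le_trans (le_normcD (f z) (- g z)) _.
  by rewrite normcN; exact: lerD.
rewrite big_cons addeC; apply: (@le_trans _ _ (L2norm2 f + L2norm2 g)%E).
  by rewrite leeD.
(* If both signs failed, adding the two strict inequalities would contradict the parallelogram
   law. *)
rewrite leNgt; apply/negP => lt2.
have := lteD lt1 lt2.
by rewrite par ltxx.
Qed.

Lemma L2norm2_le_L1norm f : (forall z, normc (f z) <= 1) ->
  (L2norm2 f <= L1norm f)%E.
Proof.
move=> f1; apply: ge0_le_integral => //.
- by move=> z _; rewrite lee_fin sqr_ge0.
- by apply/measurable_EFinP; exact: measurable_sqr_normc_csphere.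
- by apply/measurable_EFinP; exact: measurable_normc_csphere.
- by move=> z _; rewrite lee_fin expr2 ler_piMr ?normc_ge0.
Qed.

Lemma L1_incl_distE f g :
  (mdist (L1_incl sigma f) (L1_incl sigma g))%:E = L1norm (f - g)%R.
Proof. by rewrite L1_incl_mdistE. Qed.

Hypothesis sigma_inv : rotation_invariant sigma.

(** Multiplication by a unimodular [a] is the action of the unitary scalar matrix [a%:M], so the
    pushforward of [sigma] agrees with [sigma]. *)
Lemma integral_rotate (a : C) (a1 : normc a = 1) f :
  (\int[sigma]_(z in [set: S]) (normc (f (rotate a1 z)))%:E)%E = L1norm f.
Proof.
have mrot : measurable_fun [set: S] (rotate a1 : S -> S).
  apply: (@measurability _ _ S S setT _ (@open (sphere R n.+1))) => //.
  move=> _ [A oA <-]; rewrite setTI; apply: sub_sigma_algebra.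
  by have /continuousP := @continuous_rotate R n.+1 a a1; apply.
have := @ge0_integral_pushforward _ _ S S R _ mrot sigma setT
  (fun z => (normc (f z))%:E) measurableT.
move=> <-; last 2 first.
  by apply/measurable_EFinP; exact: measurable_normc_csphere.
  by move=> z _; rewrite lee_fin normc_ge0.
apply: eq_measure_integral => A mA _.
have aU : (a%:M : 'M[C]_n.+1) \is unitarymx.
  apply/unitarymxP; rewrite tr_scalar_mx map_scalar_mx -scalar_mxM.
  by rewrite -normCK normc_normr a1 expr1n.
have mB : measurable ((rotate a1 : S -> S) @^-1` A).
  by rewrite -[X in measurable X]setTI; exact: mrot.
transitivity (sigma ((rotate a1 : S -> S) @^-1` A)); first by [].
(* Invariance concerns images and the pushforward preimages; the image of the preimage is [A]
   because rotation by [a^-1] is the inverse. *)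
rewrite -(sigma_inv aU mB); congr (sigma _).
apply/seteqP; split=> [w [z Az wz]|w Aw].
  rewrite (_ : w = rotate a1 z)//; apply: sphere_val_inj.
  by rewrite wz mul_mx_scalar.
have bE : a * a^-1 = 1.
  rewrite mulfV//; apply/eqP => a0; have /eqP := a1.
  by rewrite a0 ComplexField.Normc.normc0 eq_sym oner_eq0.
have b1 : normc a^-1 = 1 by rewrite ComplexField.Normc.normcV a1 invr1.
have rotK : rotate a1 (rotate b1 w) = w.
  by apply: sphere_val_inj; rewrite !to_sphereK scalerA bE scale1r.
exists (rotate b1 w); first by rewrite /= rotK.
by rewrite mul_mx_scalar -[LHS](congr1 sphere_val rotK).
Qed.

Lemma L1norm_le_dist p p' q f g : (p' < p)%N ->
  sphere_homogeneous p q f -> sphere_homogeneous p' q g ->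
  (L1norm f <= L1norm (f - g)%R)%E.
Proof.
move=> p'p hf hg.
have [a aE] : exists a : C, a ^+ (p - p') = -1.
  (* As [p' < p], this polynomial is not constant and has a complex root. *)
  have /closed_rootP [a] : size ('X^(p - p') + 1 : {poly C}) != 1%N.
    by rewrite size_XnaddC ?subn_gt0// -(prednK (_ : 0 < p - p'))%N ?subn_gt0.
  rewrite rootE !hornerE => /eqP a0; exists a; apply/eqP.
  by rewrite -addr_eq0 a0.
have a1 : normc a = 1.
  have /(congr1 (@normc R)) := aE; rewrite normcX normcN ComplexField.Normc.normc1.
  move=> /eqP; rewrite -(expr1n _ (p - p')) eqrXn2 ?normc_ge0 ?subn_gt0//.
  by move=> /eqP ->; rewrite expr1n.
have ap : a ^+ p = - a ^+ p' by rewrite -(subnK (ltnW p'p)) exprD aE mulN1r.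
have rotE z : normc ((f - g) (rotate a1 z)) = normc ((f + g) z).
  have -> : (f - g) (rotate a1 z) = - (a ^+ p' * conjc a ^+ q * (f z + g z)).
    transitivity (f (rotate a1 z) - g (rotate a1 z)); first by [].
    by rewrite hf hg ap; ring.
  rewrite normcN !ComplexField.Normc.normcM !normcX normc_conj a1 !expr1n.
  by rewrite !mul1r.
have nn (h : csphere R n.+1) (z : S) : 0 <= normc (h z) by exact: normc_ge0.
(* Rotation turns one copy of [f - g] into [f + g] under the modulus; the triangle inequality for
   [(f - g) + (f + g)] then applies pointwise. *)
have twice : (L1norm f + L1norm f <= L1norm (f - g)%R + L1norm (f - g)%R)%E.
  rewrite -{2}(integral_rotate a1 (f - g)).
  under [X in (_ <= _ + X)%E]eq_integral do rewrite rotE.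
  have m := measurable_normc_csphere.
  rewrite /L1norm (integral_add (m f) (m f))//.
  rewrite (integral_add (m (f - g)) (m (f + g)))//.
  apply: ge0_le_integral => //.
  - by move=> z _; rewrite lee_fin addr_ge0 ?normc_ge0.
  - by apply/measurable_EFinP; exact: measurable_funD.
  - by apply/measurable_EFinP; apply: measurable_funD; exact: m.
  - move=> z _; rewrite lee_fin.
    have := le_normcD (f z - g z) (f z + g z).
    by rewrite addrACA addNr addr0 -mulr2n normcMn mulr2n.
rewrite leNgt; apply/negP => lt; have := lteD lt lt.
by rewrite ltNge twice.
Qed.

End integrals.

(** * Bounded harmonics with L1 norm bounded below, and the conclusion *)

(** A signed sum of the normalized waves has modulus at most 1, so its L1 norm dominates its squared
    L2 norm. The latter is at least the integral of the sum of squared moduli, hence at least [c] as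
    [sigma] has mass 1. *)
Lemma exists_flat_harmonic (R : realType) (n : nat)
    (sigma : probability (borel_sphere R n.+2) R) (q : nat) :
  exists2 c : R, 0 < c & forall p, (0 < p)%N -> exists f : csphere R n.+2,
  [/\ linear_span (spherical_harmonic p q) f, sphere_homogeneous p q f,
      forall z, normc (f z) <= 1 & (c%:E <= L1norm sigma f)%E].
Proof.
have [c c0 waves] := @exists_normalized_wave_family R n q.
exists c => // p /waves[k [S [So Sup Slow]]].
pose g (uv : 'rV[R[i]]_n.+2 * 'rV[R[i]]_n.+2) : csphere R n.+2 :=
  sphere_wave k p q uv.1 uv.2.
have gharm uv : uv \in S -> spherical_harmonic p q (g uv).
  move=> uvS; exists (plane_wave k p q uv.1 uv.2) => //.
  exact/harmonic_plane_wave/So.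
pose P (f : csphere R n.+2) :=
  linear_span (spherical_harmonic p q) f /\ sphere_homogeneous p q f.
have [||f [[fspan fhom] fle fL2]] := @exists_signs R n.+1 sigma P [seq g uv | uv <- S].
- by split; [exact: linear_span0|move=> a a1 z; rewrite mulr0].
- move=> f _ [fspan fhom] /mapP[uv uvS ->].
  have ghom : sphere_homogeneous p q (g uv) by exact: sphere_homogeneous_wave.
  (* Both signs become instances of [f + b *: g], with [b] equal to 1 or -1. *)
  rewrite -scaleN1r -[X in P (_ + X) /\ _]scale1r.
  by split; split; (exact: linear_spanD (gharm _ uvS)) ||
    exact: sphere_homogeneousD.
have f1 z : normc (f z) <= 1.
  by apply: le_trans (fle z) _; rewrite big_map; exact/Sup/nsq_sphere.
exists f; split=> //; apply: le_trans (L2norm2_le_L1norm sigma f1).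
apply: le_trans fL2; rewrite big_map -ge0_integral_sum//; last 2 first.
- by move=> uv; apply/measurable_EFinP; exact: measurable_sqr_normc_csphere.
- by move=> uv z _; rewrite lee_fin sqr_ge0.
apply: (@le_trans _ _ (\int[sigma]_(z in setT) (cst c%:E) z)%E).
  rewrite integral_cst// [X in (_ * X)%E](_ : _ = 1%E) ?mule1//.
  exact: probability_setT.
apply: ge0_le_integral => //.
- by move=> z _; rewrite lee_fin ltW.
- apply: emeasurable_sum => uv; apply/measurable_EFinP.
  exact: measurable_sqr_normc_csphere.
- move=> z _; rewrite sumEFin lee_fin; exact/Slow/nsq_sphere.
Qed.

Close Scope ring_scope.

(* The dimension of the complex space is n.+2, i.e. any integer at least 2. *)
Theorem corollary7p3 (R : realType) (n : nat)
    (sigma : probability (borel_sphere R n.+2) R)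
    (J : set nat) (q : nat) (X : set (csphere R n.+2)) :
  rotation_invariant sigma ->
  J `<=` [set p | (0 < p)%N] -> infinite_set J ->
  linear_subspace X -> closed X ->
  spherical_harmonics_span J q `<=` X ->
  ~ compact_operator X (L1_incl sigma).
Proof.
move=> sigma_inv J0 Jinf _ _ HX.
have [c c0 flat] := exists_flat_harmonic sigma q.
have [f fP] : exists f : nat -> csphere R n.+2, forall p, J p ->
    [/\ linear_span (spherical_harmonic p q) (f p), sphere_homogeneous p q (f p),
        forall z, (normc (f p z) <= 1)%R & (c%:E <= L1norm sigma (f p))%E].
  have ex p : exists g : csphere R n.+2, J p ->
    [/\ linear_span (spherical_harmonic p q) g, sphere_homogeneous p q g,
        forall z, (normc (g z) <= 1)%R & (c%:E <= L1norm sigma g)%E].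
    have [/J0/flat[g gP]|nJp] := pselect (J p); first by exists g.
    (* Outside [J] nothing is required, and 0 is a default value. *)
    by exists 0%R.
  by have [f fP] := choice ex; exists f.
apply: (separated_not_precompact (x := fun p => L1_incl sigma (f p)) c0 Jinf).
  move=> p Jp; have [fspan _ f1 _] := fP p Jp.
  (* [f p] lies in [X], through the span and its closure, and in the closed unit ball for the
     supremum norm. *)
  exists (f p) => //; split.
    apply/HX/subset_closure; apply: sub_linear_span fspan.
    by move=> g gp; exists p.
  rewrite /= csphere_normE -(rmorph1 (real_complex R)) lecR.
  exact/sup_norm_le.
move=> p p' Jp Jp' p'p; have [_ hp _ cp] := fP p Jp; have [_ hp' _ _] := fP p' Jp'.
rewrite -lee_fin L1_incl_distE; apply: le_trans cp _.
exact: (L1norm_le_dist sigma_inv p'p hp hp').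
Qed.
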